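(* Let $H$ be a finite graph. Then: (i) The class of all graphs (finite or infinite) that do not contain $H$ as a subgraph is better-quasi-ordered by the subgraph relation if and only if $H$ is a disjoint union of paths. (ii) For every integer $\mu \geqslant 1$, the class of all graphs (finite or infinite) of multiplicity at most $\mu$ that do not contain $H$ as a subgraph is better-quasi-ordered by the induced subgraph relation if and only if $H$ is a disjoint union of paths.
   Context: Graphs are undirected, may be finite or infinite, and may contain parallel edges and loops. Paths are finite; a single vertex is a path (of length $0$). The multiplicity of a graph $G$ is the supremum, over all (not necessarily distinct) vertices $u, v$, of the number of edges of $G$ with end vertices $u$ and $v$ (loops at $u$ if $u = v$). ''$G$ contains $H$ as a subgraph'' means that $H$ is isomorphic to a subgraph of $G$. The subgraph (respectively, induced subgraph) relation is the quasi-ordering in which $X$ is below $Y$ if $X$ is isomorphic to a subgraph (respectively, an induced subgraph) of $Y$; an induced subgraph contains all edges of $Y$, including parallel edges and loops, with both ends in its vertex set. Better-quasi-ordering. A quasi-ordering is a reflexive and transitive binary relation. Let $\mathcal{A}$ be the set of all finite (strictly) ascending sequences of nonnegative integers. For $A, B \in \mathcal{A}$, write $A <_{\mathcal{A}} B$ if there is $C \in \mathcal{A}$ such that $A$ is a strict initial subsequence of $C$ and $B$ is obtained from $C$ by deleting its first term. For an infinite subset $\mathcal{B}$ of $\mathcal{A}$, let $\bigcup\mathcal{B}$ be the set of nonnegative integers appearing in some sequence of $\mathcal{B}$; $\mathcal{B}$ is a block if it contains an initial subsequence of every infinite increasing sequence of elements of $\bigcup\mathcal{B}$. Given a class $\mathbf{Q}$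 with a quasi-ordering $\leqslant_{\mathbf{Q}}$, a $\mathbf{Q}$-pattern is a function $\varphi$ from a block $\mathcal{B}$ into $\mathbf{Q}$; it is good if there exist $A, B \in \mathcal{B}$ with $A <_{\mathcal{A}} B$ and $\varphi(A) \leqslant_{\mathbf{Q}} \varphi(B)$. $\mathbf{Q}$ is better-quasi-ordered by $\leqslant_{\mathbf{Q}}$ if every $\mathbf{Q}$-pattern is good. *)

(* Defs.v *)
From mathcomp Require Import all_boot.
From mathcomp Require Import boolp classical_sets functions cardinality.

Set Implicit Arguments.
Unset Strict Implicit.
Unset Printing Implicit Defensive.

Local Open Scope classical_set_scope.
Local Open Scope card_scope.

(* Graphs are undirected: the order of the two components of [ends e] carries no
   meaning, and isomorphisms need not respect it.  Loops and parallel edges are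
   allowed. *)
Record graph := Graph {
  vert : Type;
  edge : Type;
  ends : edge -> vert * vert
}.

Definition joins (G : graph) (e : edge G) (u v : vert G) : Prop :=
  ends e = (u, v) \/ ends e = (v, u).

Definition finite_graph (G : graph) : Prop :=
  finite_set [set: vert G] /\ finite_set [set: edge G].

Definition multiplicity_le (mu : nat) (G : graph) : Prop :=
  forall u v : vert G, [set e : edge G | joins e u v] #<= `I_mu.

Definition graph_iso (G H : graph) : Prop :=
  exists (f : vert G -> vert H) (g : edge G -> edge H),
    [/\ bijective f, bijective g &
        forall e u v, joins e u v -> joins (g e) (f u) (f v)].

Record subgraph (G : graph) := Subgraph {
  in_vert : vert G -> Prop;
  in_edge : edge G -> Prop;
  in_ends : forall e, in_edge e -> in_vert (ends e).1 /\ in_vert (ends e).2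
}.

Arguments Subgraph {G} in_vert in_edge in_ends.

Definition graph_of (G : graph) (S : subgraph G) : graph := {|
  vert := {v : vert G | in_vert S v};
  edge := {e : edge G | in_edge S e};
  ends := fun e =>
    (exist _ (ends (sval e)).1 (in_ends (svalP e)).1,
     exist _ (ends (sval e)).2 (in_ends (svalP e)).2)
|}.

Definition induced (G : graph) (S : subgraph G) : Prop :=
  forall e, in_vert S (ends e).1 -> in_vert S (ends e).2 -> in_edge S e.

Definition subgraph_le (X Y : graph) : Prop :=
  exists S : subgraph Y, graph_iso X (graph_of S).

Definition induced_subgraph_le (X Y : graph) : Prop :=
  exists S : subgraph Y, induced S /\ graph_iso X (graph_of S).

(* the path of length [n]: vertices 0, ..., n, the edge [i] joining i and i+1 *)
Definition path_graph (n : nat) : graph := {|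
  vert := 'I_n.+1;
  edge := 'I_n;
  ends := fun i => (widen_ord (leqnSn n) i, lift ord0 i)
|}.

Definition disjoint_union (I : Type) (G : I -> graph) : graph := {|
  vert := {i : I & vert (G i)};
  edge := {i : I & edge (G i)};
  ends := fun e => let: existT i d := e in
    (existT _ i (ends d).1, existT _ i (ends d).2)
|}.

Definition disjoint_union_of_paths (G : graph) : Prop :=
  exists (I : Type) (len : I -> nat),
    graph_iso G (disjoint_union (fun i => path_graph (len i))).

Definition ascending (A : seq nat) : Prop := sorted ltn A.

Definition seq_lt (A B : seq nat) : Prop :=
  exists C : seq nat,
    [/\ ascending C, prefix A C, A <> C & B = behead C].

Definition support (B : seq nat -> Prop) (n : nat) : Prop :=
  exists A, B A /\ n \in A.

Definition block (B : seq nat -> Prop) : Prop :=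
  [/\ forall A, B A -> ascending A,
      infinite_set B &
      forall s : nat -> nat,
        {homo s : m n / (m < n)%N} -> (forall n, support B (s n)) ->
        exists n, B (mkseq s n)].

Definition good (T : Type) (le : T -> T -> Prop) (B : seq nat -> Prop)
    (phi : {A | B A} -> T) : Prop :=
  exists A A' : {A | B A}, seq_lt (sval A) (sval A') /\ le (phi A) (phi A').

Definition better_quasi_ordered (T : Type) (Q : T -> Prop)
    (le : T -> T -> Prop) : Prop :=
  forall B : seq nat -> Prop, block B ->
  forall phi : {A | B A} -> T, (forall A, Q (phi A)) -> good le phi.

(* Main.v *)
Require Import Defs.
From mathcomp Require Import all_boot.
From mathcomp Require Import boolp classical_sets functions cardinality wochoice.
From mathcomp Require Import zify.

(** A graph without [H], where [H] is a finite disjoint union of paths, has no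
    path of some length [n].  Then the structure of the graph is bounded: choose
    a root in each component and delete it; in what remains, each component
    contains a neighbour of the deleted root, and from that neighbour there start
    only paths shorter than those from the root.  After [n] rounds nothing is
    left.  This works for graphs of any cardinality.  So a graph is built in
    finitely many steps, a step being either to add a root, which is recorded in
    the labels of the other vertices, or to take a family of disjoint components.
    Adding a root amounts to a finite product of orders ([rooted_bqo]), and
    families are the heart of the matter ([simpson_bqo_family]).

    A family [f] of elements of a better-quasi-order [Q] is dominated by [g]
    along an injection if and only if every upward closed subset of [Q] contains
    at least as many members of [g] as of [f], in the sense of cardinals
    ([family_domination]).  Finitely many members of [f] lie below only finitely
    many others, and Hall's theorem handles them; the rest are placed greedily by
    transfinite recursion, and the existence of finite bases in [Q] shows that
    space never runs out.  Hence families embed into the sets of pairs of an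
    upward closed set and a cardinal, and it is enough that better-quasi-orders
    are closed under products and under the two orders on subsets that come from
    domination and refinement, and that cardinals are well-ordered.

    These closure properties are proved for Simpson's form of the notion, which
    speaks of locally constant maps on the infinite subsets of the natural
    numbers in place of blocks.  The tool is the Ramsey theorem for clopen
    partitions ([clopen_ramsey]); it gives the closure under products and the
    passage back to blocks ([simpson_bqo_block]).

    Weights and labels are handled uniformly.  For the subgraph relation the
    weight of a pair of vertices is the cardinal number of edges between them,
    ordered by size; for the induced subgraph relation the weights are the
    numbers up to [mu], ordered by equality.

    Conversely, long cycles form an infinite antichain under the subgraph
    relation, and a graph [H] contained in a cycle with more vertices than [H]
    misses one of them, hence is a disjoint union of paths
    ([disjoint_union_of_paths_of_bqo]). *)

Set Implicit Arguments.
Unset Strict Implicit.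
Unset Printing Implicit Defensive.

Local Open Scope classical_set_scope.
Local Open Scope card_scope.

(** * Ramsey's theorem for clopen partitions *)

(** An infinite set of natural numbers is represented by its increasing
    enumeration, and [shift] removes its least element. *)
Definition incr (X : nat -> nat) : Prop := {homo X : m n / m < n}.
Definition shift (X : nat -> nat) : nat -> nat := fun k => X k.+1.
Definition within (X Z : nat -> nat) : Prop := forall k, exists j, X k = Z j.
Definition prepend (a : seq nat) (X : nat -> nat) : nat -> nat :=
  fun i => if i < size a then nth 0 a i else X (i - size a).

(** Local constancy on the space of infinite subsets of the natural numbers: the
    value is decided by a finite initial segment.  For subsets of the space this
    is being clopen. *)
Definition clopen T (g : (nat -> nat) -> T) : Prop :=
  forall X, incr X ->
  exists n, forall Y, incr Y -> (forall i, i < n -> Y i = X i) -> g Y = g X.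

Lemma incr_mono X m n : incr X -> (X m < X n) = (m < n).
Proof.
move=> iX; case: (ltnP m n) => [/iX //|].
rewrite leq_eqVlt => /orP[/eqP->|/iX]; lia.
Qed.

Lemma incr_step X : (forall k, X k < X k.+1) -> incr X.
Proof.
move=> sX m n; elim: n => // n IH; rewrite ltnS leq_eqVlt => /orP[/eqP->//|/IH].
by move: (sX n); lia.
Qed.

Lemma incr_shift X : incr X -> incr (shift X).
Proof. by move=> iX m n mn; apply: iX. Qed.

Lemma incr_comp X Y : incr Y -> incr X -> incr (Y \o X).
Proof. by move=> iY iX m n mn; apply/iY/iX. Qed.

Lemma incr_id : incr id. Proof. by []. Qed.

Lemma within_trans X Y Z : within X Y -> within Y Z -> within X Z.
Proof. by move=> XY YZ k; have [j ->] := XY k; apply: YZ. Qed.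

Lemma within_comp X Y : within (Y \o X) Y.
Proof. by move=> k; exists (X k). Qed.

Lemma prepend_rcons a X : prepend (rcons a (X 0)) (shift X) = prepend a X.
Proof.
apply: funext => i; rewrite /prepend size_rcons nth_rcons /shift.
case: (ltngtP i (size a)) => [h|h|->].
- by rewrite (ltn_trans h).
- by rewrite ltnNge h /=; congr (X _); lia.
- by rewrite ltnSn subnn.
Qed.

Lemma incr_prepend a Y Z : incr (prepend a Z) -> incr Y -> within Y Z -> incr (prepend a Y).
Proof.
move=> ia iY YZ m n mn; rewrite /prepend.
case: (ltnP n (size a)) => [h|h].
  by have := ia m n mn; rewrite /prepend h (ltn_trans mn h).
case: (ltnP m (size a)) => [h'|h']; last by apply: iY; lia.
have [j ->] := YZ (n - size a).
have := ia m (size a + j); rewrite /prepend h' addKn.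
have -> : (size a + j < size a) = false by lia.
by apply; lia.
Qed.

Lemma prepend_mkseq s n i X : i < n -> prepend (mkseq s n) X i = s i.
Proof. by move=> h; rewrite /prepend size_mkseq h nth_mkseq. Qed.

Lemma infinitely_often (P : nat -> Prop) :
  (forall m, exists2 k, m <= k & P k) -> exists2 h, incr h & forall k, P (h k).
Proof.
move=> inf; have /choice[f fP] : forall m, exists k, m <= k /\ P k.
  by move=> m; have [k] := inf m; exists k.
pose h := fix h k := f (if k is k'.+1 then (h k').+1 else 0).
exists h; last by case=> [|k]; apply: (fP _).2.
by apply: incr_step => k; apply: (fP (h k).+1).1.
Qed.

Lemma homogeneous_subseq (P : nat -> Prop) :
  exists2 h, incr h & (forall k, P (h k)) \/ (forall k, ~ P (h k)).
Proof.
have [[m mP]|nP] := pselect (exists m, forall k, m <= k -> ~ P k).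
  exists (addn m) => [i j|]; first by rewrite ltn_add2l.
  by right=> k; apply: mP; apply: leq_addr.
have [|h ih hP] := @infinitely_often P; last by exists h => //; left.
move=> m; apply: contrapT => nm; apply: nP; exists m => k mk Pk.
by apply: nm; exists k.
Qed.

Definition homogeneous (c : (nat -> nat) -> Prop) (Y : nat -> nat) : Prop :=
  (forall X, incr X -> within X Y -> c X) \/ (forall X, incr X -> within X Y -> ~ c X).

(** The Ramsey property localised at a finite sequence [a] already chosen: it
    holds for trivial reasons once [a] decides [c], and it passes from all
    one-step extensions of [a] to [a]. *)
Definition ramsey_after (c : (nat -> nat) -> Prop) (a : seq nat) : Prop :=
  forall Z, incr Z -> incr (prepend a Z) ->
  exists Y, [/\ incr Y, within Y Z & homogeneous (fun X => c (prepend a X)) Y].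

(** Diagonalisation: refine successively so that the colour after [a] followed
    by the [k]-th element chosen is constant on what remains, then keep the
    elements whose constants agree. *)
Lemma ramsey_after_rcons c a :
  (forall n, ramsey_after c (rcons a n)) -> ramsey_after c a.
Proof.
move=> Ha Z0 iZ0 iaZ0.
have step Z : exists Y, incr Z -> incr (prepend a Z) ->
    [/\ incr Y, within Y (shift Z) & homogeneous (fun X => c (prepend (rcons a (Z 0)) X)) Y].
  case: (pselect (incr Z)) => iZ; last by exists Z.
  case: (pselect (incr (prepend a Z))) => iaZ; last by exists Z.
  have [|Y HY] := Ha (Z 0) (shift Z) (incr_shift iZ); first by rewrite prepend_rcons.
  by exists Y.
have [F FP] := choice step.
pose Zs k := iter k F Z0.
have sub_shift Z : within (shift Z) Z by move=> k; exists k.+1.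
have ZsP k : incr (Zs k) /\ incr (prepend a (Zs k)).
  elim: k => [//|k [i1 i2]] /=; have [i3 s _] := FP _ i1 i2.
  by split=> //; apply: (incr_prepend i2 i3); apply: within_trans s (sub_shift _).
have ZsS k : within (Zs k.+1) (shift (Zs k)).
  by have [i1 i2] := ZsP k; have [] := FP _ i1 i2.
have ZsD j k : within (Zs (j + k)) (Zs k).
  elim: j => [|j IH]; first by move=> i; exists i.
  by rewrite addSn; apply: within_trans (ZsS _) _; apply: within_trans IH.
pose N k := Zs k 0.
have iN : incr N.
  apply: incr_step => k; rewrite /N; have [j ->] := ZsS k 0.
  by have [i1 _] := ZsP k; apply: i1.
have [h ih hP] := homogeneous_subseq
  (fun k => forall X, incr X -> within X (Zs k.+1) -> c (prepend (rcons a (N k)) X)).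
have key X : incr X -> within X (N \o h) -> exists j,
    [/\ incr (shift X), within (shift X) (Zs (h j).+1) &
        prepend a X = prepend (rcons a (N (h j))) (shift X)].
  move=> iX sX; have [j Xj] := sX 0; exists j; split; first exact: incr_shift.
    move=> k; have [j' Xj'] := sX k.+1; rewrite /shift Xj' /=.
    have : N (h j) < N (h j') by rewrite -[N (h j)]Xj -[N (h j')]Xj'; apply: iX.
    rewrite (incr_mono _ _ iN) => hjj'.
    by have := ZsD (h j' - (h j).+1) (h j).+1 0; rewrite subnK.
  by rewrite -[N (h j)]Xj prepend_rcons.
exists (N \o h); split; first exact: incr_comp.
  move=> k; have := ZsD (h k) 0 0; rewrite addn0 => -[j e].
  by exists j.
case: hP => hP; [left|right] => X iX /(key X iX)[j [i1 s1 ->]]; first exact: hP.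
have [i2 i3] := ZsP (h j); have [_ _ hom] := FP _ i2 i3.
case: hom => hom; last exact: hom.
by have := hP j => nP; exfalso; apply: nP => X' i4 s4; apply: hom.
Qed.

(** If the property fails at the empty sequence, it fails along a whole
    infinite branch; but a finite initial segment of that branch decides [c]. *)
Theorem clopen_ramsey (c : (nat -> nat) -> Prop) :
  clopen c -> exists2 Y, incr Y & homogeneous c Y.
Proof.
move=> ctsc; apply: contrapT => nhom.
have n0 : ~ ramsey_after c [::].
  move=> /(_ id incr_id); have c0 X : prepend [::] X = X.
    by apply: funext => i; rewrite /prepend /= subn0.
  rewrite c0 => /(_ incr_id)[Y [iY _ hY]]; apply: nhom; exists Y => //.
  by case: hY => hY; [left|right] => X i s; have := hY X i s; rewrite c0.
have step a : exists n, ~ ramsey_after c a -> ~ ramsey_after c (rcons a n).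
  apply: contrapT => nn; apply: (nn); exists 0 => na; exfalso; apply: na.
  apply: ramsey_after_rcons => n; apply: contrapT => nr; apply: nn.
  by exists n.
have [F FP] := choice step.
pose As := fix As k := if k is k'.+1 then rcons (As k') (F (As k')) else [::].
pose s k := F (As k).
have Ase k : As k = mkseq s k by elim: k => // k IH; rewrite mkseqS -IH.
have nAs k : ~ ramsey_after c (mkseq s k).
  by rewrite -Ase; elim: k => // k IH; apply: FP.
have is_ : incr s.
  move=> m n mn; apply: contrapT => nmn; apply: (nAs n.+1) => Z _ /(_ m n mn).
  by rewrite !prepend_mkseq ?(ltn_trans mn).
have [n sn] := ctsc s is_; apply: (nAs n) => Z iZ iaZ.
exists Z; split=> //; first by move=> k; exists k.
have e X : incr X -> within X Z -> c (prepend (mkseq s n) X) = c s.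
  move=> iX XZ; apply: sn; first exact: incr_prepend iaZ _ _.
  by move=> i; apply: prepend_mkseq.
by have [cs|ncs] := pselect (c s); [left|right] => X iX XZ; rewrite e.
Qed.

(** * Better-quasi-orders by locally constant maps *)

(** Better-quasi-ordering in Simpson's form.  Locally constant maps need no
    bookkeeping of block elements of different lengths, so that the closure
    properties below have short proofs. *)
Definition simpson_bqo T (Q : T -> Prop) (le : T -> T -> Prop) : Prop :=
  forall g : (nat -> nat) -> T, clopen g -> (forall X, incr X -> Q (g X)) ->
  exists2 X, incr X & le (g X) (g (shift X)).

Lemma clopen_shift T (g : (nat -> nat) -> T) :
  clopen g -> clopen (fun X => g (shift X)).
Proof.
move=> cg X iX; have [n gn] := cg _ (incr_shift iX).
exists n.+1 => Y iY XY; apply: gn; first exact: incr_shift.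
by move=> i h; apply: XY.
Qed.

Lemma clopen_map2 T1 T2 T (f : T1 -> T2 -> T) g1 g2 :
  clopen g1 -> clopen g2 -> clopen (fun X => f (g1 X) (g2 X)).
Proof.
move=> c1 c2 X iX; have [[n1 h1] [n2 h2]] := (c1 X iX, c2 X iX).
exists (maxn n1 n2) => Y iY XY; rewrite h1 ?h2 // => i h; apply: XY; lia.
Qed.

Lemma clopen_map T1 T (f : T1 -> T) g : clopen g -> clopen (fun X => f (g X)).
Proof. by move=> cg; apply: (clopen_map2 (fun x _ => f x) cg cg). Qed.

Lemma clopen_comp T (g : (nat -> nat) -> T) Y :
  clopen g -> incr Y -> clopen (fun X => g (Y \o X)).
Proof.
move=> cg iY X iX; have [n gn] := cg _ (incr_comp iY iX).
exists n => Z iZ XZ; apply: gn; first exact: incr_comp.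
by move=> i h /=; rewrite XZ.
Qed.

(** Along [X, shift X, shift (shift X), ...] a bad map would be a sequence with
    no two consecutive terms in order. *)
Lemma simpson_bqo_seq T (Q : T -> Prop) le :
  (forall u : nat -> T, (forall n, Q (u n)) -> exists n, le (u n) (u n.+1)) ->
  simpson_bqo Q le.
Proof.
move=> H g cg Qg; pose X n := addn n.
have iX n : incr (X n) by move=> i j ij; rewrite /X ltn_add2l.
have [n|n h] := H (fun n => g (X n)); first exact: Qg.
exists (X n) => //; rewrite (_ : shift _ = X n.+1) //.
by apply: funext => i; rewrite /shift /X addnS addSn.
Qed.

Lemma simpson_bqo_wqo T (Q : T -> Prop) le (u : nat -> T) :
  simpson_bqo Q le -> (forall n, Q (u n)) ->
  exists i j, i < j /\ le (u i) (u j).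
Proof.
move=> bQ Qu; have [||X iX h] := bQ (fun X => u (X 0)) => //.
  by move=> X _; exists 1 => Y _ ->.
by exists (X 0), (X 1); split=> //; apply: iX.
Qed.

(** By Ramsey, the first coordinates may be assumed to be always in order or
    never in order; the second case is excluded by the first factor. *)
Lemma simpson_bqo_prod T1 T2 (Q1 : T1 -> Prop) (Q2 : T2 -> Prop) le1 le2 :
  simpson_bqo Q1 le1 -> simpson_bqo Q2 le2 ->
  simpson_bqo (fun x : T1 * T2 => Q1 x.1 /\ Q2 x.2)
              (fun x y => le1 x.1 y.1 /\ le2 x.2 y.2).
Proof.
move=> b1 b2 g cg Qg.
have cc : clopen (fun X => le1 (g X).1 (g (shift X)).1).
  by apply: (clopen_map2 (fun x y => le1 x.1 y.1)) => //; apply: clopen_shift.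
have [Y iY hom] := clopen_ramsey cc.
case: hom => hom.
  have [||X iX h] := b2 (fun X => (g (Y \o X)).2).
  - exact/(clopen_map snd)/clopen_comp.
  - by move=> X iX; have [] := Qg _ (incr_comp iY iX).
  exists (Y \o X); first exact: incr_comp.
  by split=> //; apply: hom; [apply: incr_comp|apply: within_comp].
have [||X iX h] := b1 (fun X => (g (Y \o X)).1).
- exact/(clopen_map fst)/clopen_comp.
- by move=> X iX; have [] := Qg _ (incr_comp iY iX).
by case: (hom (Y \o X)); [apply: incr_comp|apply: within_comp|].
Qed.

Lemma choice_on T U (P : T -> Prop) (R : T -> U -> Prop) (u0 : U) :
  (forall x, P x -> exists y, R x y) -> exists f, forall x, P x -> R x (f x).
Proof.
move=> H; have /choice[f fP] : forall x, exists y, P x -> R x y.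
  move=> x; have [/H[y Ry]|nP] := pselect (P x); first by exists y.
  by exists u0 => /nP.
by exists f.
Qed.

Lemma choice_on2 T U (P : T -> Prop) (B R : T -> U -> Prop) (u0 : U) :
  (forall x, P x -> exists2 y, B x y & R x y) ->
  exists f, forall x, P x -> B x (f x) /\ R x (f x).
Proof.
move=> H; apply: (choice_on (R := fun x y => B x y /\ R x y) u0) => x /H[y Bxy Rxy].
by exists y.
Qed.

(** The encoding is a relation because codes often involve choices, such as a
    root or a representative of each component. *)
Lemma simpson_bqo_reflect T T' (Q : T -> Prop) (Q' : T' -> Prop) le le'
    (code : T -> T' -> Prop) :
  (forall x, Q x -> exists2 y, Q' y & code x y) ->
  (forall x x' y y', Q x -> Q x' -> code x y -> code x' y' -> le' y y' -> le x x') ->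
  simpson_bqo Q' le' -> simpson_bqo Q le.
Proof.
move=> Qcode codeP bQ' g cg Qg.
have [y0 _ _] := Qcode _ (Qg id incr_id).
have [r rP] := choice_on2 y0 Qcode.
have [||X iX gX] := bQ' (fun X => r (g X)); first exact: clopen_map.
  by move=> X iX; have [] := rP _ (Qg X iX).
have [Q1 Q2] := (Qg _ iX, Qg _ (incr_shift iX)).
by exists X => //; apply: codeP gX => //; [have [] := rP _ Q1|have [] := rP _ Q2].
Qed.

(** A failure of [le' S S'] has a witness in [T]; if witnesses of consecutive
    failures are never in order, a bad map to [T'] yields a bad map to [T]. *)
Lemma simpson_bqo_witness T T' (Q : T -> Prop) le (Q' : T' -> Prop)
    (le' : T' -> T' -> Prop) (W : T' -> T' -> T -> Prop) :
  (forall S S', Q' S -> Q' S' -> ~ le' S S' -> exists2 x, Q x & W S S' x) ->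
  (forall S1 S2 S3 x y, W S1 S2 x -> W S2 S3 y -> ~ le x y) ->
  simpson_bqo Q le -> simpson_bqo Q' le'.
Proof.
move=> WQ Wle bQ g cg Qg; apply: contrapT => bad.
have nle X : incr X -> ~ le' (g X) (g (shift X)).
  by move=> iX h; apply: bad; exists X.
have Qs X : incr X -> exists2 x, Q x & W (g X) (g (shift X)) x.
  by move=> iX; apply: WQ (nle _ iX); apply: Qg => //; apply: incr_shift.
have [x0 _ _] := Qs id incr_id.
have [w wP] := choice_on2 (P := fun p : T' * T' => exists2 x, Q x & W p.1 p.2 x)
  (B := fun=> Q) (R := fun p => W p.1 p.2) x0 (fun p h => h).
have [||X iX h] := bQ (fun X => w (g X, g (shift X))).
- by apply: (clopen_map2 (fun x y => w (x, y))) => //; apply: clopen_shift.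
- by move=> X /Qs/(wP (_, _))[].
have [_ w1] := wP (_, _) (Qs X iX).
have [_ w2] := wP (_, _) (Qs _ (incr_shift iX)).
exact: Wle w1 w2 h.
Qed.

Definition dominated T (le : T -> T -> Prop) (S S' : T -> Prop) : Prop :=
  forall x, S x -> exists2 y, S' y & le x y.

Definition refines T (le : T -> T -> Prop) (S S' : T -> Prop) : Prop :=
  forall y, S' y -> exists2 x, S x & le x y.

Lemma simpson_bqo_dominated T (Q : T -> Prop) le :
  simpson_bqo Q le -> simpson_bqo (fun S : T -> Prop => forall x, S x -> Q x) (dominated le).
Proof.
apply: (simpson_bqo_witness (W := fun S S' x => S x /\ forall y, S' y -> ~ le x y)).
  move=> S S' SQ _ /existsNP[x /not_implyP[Sx nx]]; exists x; first exact: SQ.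
  by split=> // y S'y xy; apply: nx; exists y.
by move=> S1 S2 S3 x y [_ h] [/h].
Qed.

Lemma simpson_bqo_refines T (Q : T -> Prop) le :
  simpson_bqo Q le -> simpson_bqo (fun S : T -> Prop => forall x, S x -> Q x) (refines le).
Proof.
apply: (simpson_bqo_witness (W := fun S S' x => S' x /\ forall y, S y -> ~ le y x)).
  move=> S S' _ SQ /existsNP[x /not_implyP[Sx nx]]; exists x; first exact: SQ.
  by split=> // y S'y xy; apply: nx; exists y.
by move=> S1 S2 S3 x y [S2x _] [_]; apply.
Qed.

(** Only finitely many ascending sequences have all their terms below [m]. *)
Lemma block_support B m : block B -> exists2 k, m <= k & Defs.support B k.
Proof.
move=> [asc inf _]; apply: contrapT => nk; apply: inf.
apply: (@sub_finite_set _ _ [set mask (tval t) (iota 0 m) | t in [set: m.-tuple bool]]);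
  last by apply: finite_image; apply: finite_finset.
move=> A BA; have lt x : x \in A -> x < m.
  move=> xA; rewrite ltnNge; apply/negP => mx; apply: nk; exists x => //.
  by exists A.
have e : A = [seq x <- iota 0 m | x \in A].
  apply: (irr_sorted_eq ltn_trans ltnn); first exact: asc.
    by apply: sorted_filter; [exact: ltn_trans|exact: iota_ltn_sorted].
  move=> x; rewrite mem_filter mem_iota /= add0n.
  by case: (boolP (x \in A)) => // /lt ->.
exists (map_tuple (fun x => x \in A) (iota_tuple m 0)) => //=.
by rewrite -filter_mask -e.
Qed.

Lemma seq_lt_mkseq X m n :
  incr X -> m <= n -> seq_lt (mkseq X m) (mkseq (shift X) n).
Proof.
move=> iX mn; exists (mkseq X n.+1); split.
- rewrite /ascending; apply/(sortedP 0) => i; rewrite size_mkseq => h.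
  by rewrite !nth_mkseq ?(ltnW h) //; apply: iX.
- rewrite prefixE size_mkseq; apply/eqP; rewrite /mkseq -map_take take_iota.
  by congr (map _ (iota _ _)); lia.
- by move/(congr1 size); rewrite !size_mkseq; lia.
- by rewrite /mkseq /= -[1]addn0 iotaDl -map_comp.
Qed.

(** Each infinite set is mapped to the shortest element of the block that starts
    it.  The lengths for [X] and [shift X] can be in the wrong order for [seq_lt],
    but not for all subsets of an infinite set, since lengths cannot decrease
    forever; so by Ramsey they are in the right order everywhere below some
    infinite set. *)
Theorem simpson_bqo_block T (Q : T -> Prop) le :
  simpson_bqo Q le -> better_quasi_ordered Q le.
Proof.
move=> bQ B blB phi Qphi.
have [e ie eB] := infinitely_often (fun m => block_support m blB).
have [_ infB hitB] := blB.
have [A0 BA0] := infinite_setN0 infB.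
have hit X : incr X -> exists n, `[< B (mkseq (e \o X) n) >].
  move=> iX; have [||n Bn] := hitB (e \o X); first exact: incr_comp.
    by move=> n; apply: eB.
  by exists n; apply/asboolP.
have [L LP] : exists L : (nat -> nat) -> nat, forall X, incr X ->
    B (mkseq (e \o X) (L X)) /\ forall n, B (mkseq (e \o X) n) -> L X <= n.
  apply: (choice_on (R := fun X l => B (mkseq (e \o X) l) /\
    forall n, B (mkseq (e \o X) n) -> l <= n) 0) => X /hit hX.
  case: (ex_minnP hX) => l /asboolP Bl lmin; exists l; split=> // n Bn.
  by apply: lmin; apply/asboolP.
have same X Y n : (forall i, i < n -> Y i = X i) ->
    forall k, k <= n -> mkseq (e \o Y) k = mkseq (e \o X) k.
  move=> XY k kn; apply: (@eq_from_nth _ 0); rewrite !size_mkseq // => i ik.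
  by rewrite !nth_mkseq //= XY //; lia.
have cL : clopen L.
  move=> X iX; exists (L X) => Y iY /same XY.
  have [[BX minX] [BY minY]] := (LP X iX, LP Y iY).
  have le1 : L Y <= L X by apply: minY; rewrite XY.
  by apply/eqP; rewrite eqn_leq le1 minX // -XY.
have cmp : clopen (fun X => L X <= L (shift X) : Prop).
  exact: (clopen_map2 (fun m n => m <= n : Prop)) cL (clopen_shift cL).
have [Y iY hom] := clopen_ramsey cmp.
case: hom => hom; last first.
  have dec k : L (iter k shift Y) + k <= L Y.
    have itP j : incr (iter j shift Y) /\ within (iter j shift Y) Y.
      elim: j => [|j [i1 s1]]; first by split=> // j; exists j.
      by split=> /=; [apply: incr_shift|move=> i; apply: s1].
    elim: k => [|k IH]; first by rewrite addn0.
    have [i1 s1] := itP k; have /negP := hom _ i1 s1.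
    by rewrite iterS; lia.
  by have := dec (L Y).+1; lia.
pose F a : {A | B A} :=
  if pselect (B a) is left p then exist _ a p else exist _ A0 BA0.
pose G X := F (mkseq (e \o X) (L X)).
have GE X : incr X -> sval (G X) = mkseq (e \o X) (L X).
  by move=> /LP[BX _]; rewrite /G /F; case: pselect.
have cG : clopen G.
  move=> X iX; have [n nL] := cL X iX.
  exists (maxn n (L X)) => Z iZ XZ; rewrite /G nL //; last first.
    by move=> i h; apply: XZ; lia.
  by rewrite (same X Z (maxn n (L X))) //; lia.
have [||X iX h] := bQ (fun X => phi (G (Y \o X))) => //.
  exact/(clopen_map phi)/clopen_comp.
exists (G (Y \o X)), (G (Y \o shift X)); split=> //.
have iYX := incr_comp iY iX.
rewrite !GE //; last exact/incr_comp/incr_shift.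
apply: (@seq_lt_mkseq (e \o (Y \o X))); first exact: incr_comp.
by apply: (hom _ iYX); apply: within_comp.
Qed.

(** * Comparison of cardinalities *)

(** Comparison of cardinalities by a relation avoids default values when the
    target type may be empty. *)
Lemma card_le_rel T U (A : set T) (B : set U) (R : T -> U -> Prop) :
  (forall x, A x -> exists2 y, B y & R x y) ->
  (forall x x' y, A x -> A x' -> R x y -> R x' y -> x = x') -> A #<= B.
Proof.
move=> tot inj.
have [[x0 Ax0]|nA] := pselect (exists x, A x); last first.
  by rewrite (_ : A = set0) ?card_ge0 //; apply/seteqP; split=> // x Ax; case: nA; exists x.
have [y0 _ _] := tot _ Ax0.
have [f fP] := choice_on2 y0 tot.
have fB : set_fun A B f by move=> x /fP[].
have fI : set_inj A f.
  move=> x x' /set_mem Ax /set_mem Ax' e; apply: (inj _ _ (f x)) => //.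
    by have [] := fP x Ax.
  by rewrite e; have [] := fP x' Ax'.
apply: card_le_trans (subset_card_le (_ : f @` A `<=` B)); last first.
  by move=> _ [x Ax <-]; apply: fB.
by have /card_eqPle[] := inj_card_eq fI.
Qed.

Lemma card_le_inj T U (A : set T) (B : set U) : A #<= B ->
  exists R : T -> U -> Prop, (forall x, A x -> exists2 y, B y & R x y) /\
    (forall x x' y, A x -> A x' -> R x y -> R x' y -> x = x').
Proof.
move=> /card_leP[f]; exists (fun x y => exists a : A, val a = x /\ val (f a) = y).
split.
  move=> x Ax; exists (val (f (SigSub (mem_set Ax)))); first exact/set_mem/valP.
  by exists (SigSub (mem_set Ax)).
move=> x x' y Ax Ax' [a [<- ay]] [b [<- by_]]; congr (val _).
by apply: (@inj _ _ _ f); rewrite ?inE //; apply: val_inj; rewrite ay by_.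
Qed.

Lemma maximal_clique T (P : T -> T -> Prop) :
  exists S : set T, (forall x y, S x -> S y -> P x y) /\
    (forall x, P x x -> (forall y, S y -> P x y /\ P y x) -> S x).
Proof.
pose clique (S : set T) := forall x y, S x -> S y -> P x y.
have [|S [cS maxS]] := @Zorn_bigcup T clique.
  move=> F Fc tot x y [X FX Xx] [Y FY Yy].
  by have [XY|YX] := tot _ _ FX FY; [apply: (Fc _ FY) => //; apply: XY|
    apply: (Fc _ FX) => //; apply: YX].
exists S; split=> // x Pxx Px; apply: contrapT => nSx.
apply: (maxS (S `|` [set x])).
  by split=> [y Sy|sub]; [left|apply/nSx/sub; right].
by move=> y z [Sy|->] [Sz|->] //; [apply: cS|apply: (Px y Sy).2|apply: (Px z Sz).1].
Qed.

(** Hoenig's argument: take a maximal set of choice functions that pairwise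
    differ in every coordinate.  Some coordinate is exhausted by it, as otherwise
    one more choice function could be added, and this coordinate injects into
    all the others. *)
Lemma card_le_min (K : Type) (T : K -> Type) (A : forall k, set (T k)) (k0 : K) :
  exists k, forall k', A k #<= A k'.
Proof.
pose P (x y : forall k, T k) := (forall k, A k (x k)) /\ (forall k, x k = y k -> x = y).
have [S [cS maxS]] := maximal_clique P.
have [[k kP]|nk] := pselect (exists k, forall t, A k t -> exists2 x, S x & x k = t).
  exists k => k'.
  apply: (@card_le_rel _ _ _ _ (fun t u => exists x, [/\ S x, x k = t & x k' = u])).
    move=> t /kP[x Sx xt]; exists (x k'); first by have [] := cS x x Sx Sx.
    by exists x.
  move=> t t' u _ _ [x [Sx <- xu]] [y [Sy <- yu]].
  by have [_ e] := cS x y Sx Sy; rewrite (e k') // xu.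
have H k : exists t, A k t /\ forall x, S x -> x k <> t.
  apply: contrapT => nt; apply: nk; exists k => t At; apply: contrapT => nx.
  by apply: nt; exists t; split=> // x Sx e; apply: nx; exists x.
pose z k := sval (cid (H k)).
have zP k : A k (z k) /\ forall x, S x -> x k <> z k := svalP (cid (H k)).
have Sz : S z.
  apply: maxS; first by split=> // k; have [] := zP k.
  move=> y Sy; split; split=> [k|k e].
  - by have [] := zP k.
  - by have [_ /(_ y Sy)] := zP k; rewrite e.
  - by have [] := cS y y Sy Sy.
  - by have [_ /(_ y Sy)] := zP k; rewrite e.
by have [_ /(_ z Sz)] := zP k0.
Qed.

Lemma card_le_total T U (A : set T) (B : set U) : A #<= B \/ B #<= A.
Proof.
pose C (b : bool) : set (if b then T else U) :=
  if b return set (if b then T else U) then A else B.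
have [[] kP] := card_le_min C true; first by left; apply: (kP false).
by right; apply: (kP true).
Qed.

(** Up to a finite remainder [A] is a disjoint union of countable sequences (take
    a maximal disjoint family), and doubling the indices makes room for two
    copies of every sequence. *)
Lemma card_le_setM_bool T (A : set T) :
  infinite_set A -> A `*` [set: bool] #<= A.
Proof.
move=> infA.
pose P (s s' : nat -> T) :=
  (forall n, A (s n)) /\ forall n n', s n = s' n' -> s = s' /\ n = n'.
have [S [cS maxS]] := maximal_clique P.
pose C := [set t | A t /\ forall s, S s -> forall n, s n <> t].
have finC : finite_set C.
  apply: contrapT => /infiniteP/card_le_inj[R [Rtot Rinj]].
  have /choice[s sP] n : exists t, C t /\ R n t.
    by have [t] := Rtot n I; exists t.
  have Ss : S s.
    apply: maxS; first split=> [n|n n' e].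
    - by have [[]] := sP n.
    - split=> //; apply: (Rinj _ _ (s n)) => //; first by have [] := sP n.
      by rewrite e; have [] := sP n'.
    move=> s' Ss'; split; split.
    - by move=> n; have [[]] := sP n.
    - by move=> n n' e; have [[_ /(_ s' Ss' n')]] := sP n; rewrite e.
    - by have [] := cS _ _ Ss' Ss'.
    - by move=> n n' e; have [[_ /(_ s' Ss' n)]] := sP n'; rewrite e.
  by have [[_ /(_ s Ss 0)]] := sP 0.
have [s0 Ss0] : exists s0, S s0.
  apply: contrapT => nS; apply: infA; apply: sub_finite_set finC => t At.
  by split=> // s Ss; case: nS; exists s.
have /finite_set_leP[r /card_le_inj[rho [rhoT rhoI]]] := finC.
(* C is absorbed by the sequence s0, shifted by r *)
pose d s := if pselect (s = s0) then r else 0.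
pose code t (p : (nat -> T) * nat) := S p.1 /\
  ((exists n, t = p.1 n /\ p.2 = n + d p.1) \/
   (C t /\ p.1 = s0 /\ rho t p.2 /\ p.2 < r)).
have codeT t : A t -> exists p, code t p.
  move=> At; have [Ct|nCt] := pselect (C t).
    have [k kr tk] := rhoT t Ct.
    by exists (s0, k); split=> //; right.
  have [s Ss [n sn]] : exists2 s, S s & exists n, s n = t.
    apply: contrapT => nst; apply: nCt; split=> // s Ss n sn; apply: nst.
    by exists s => //; exists n.
  by exists (s, n + d s); split=> //; left; exists n.
have d0 : d s0 = r by rewrite /d; case: pselect.
have codeI t t' p : code t p -> code t' p -> t = t'.
  move=> [Sp [[n [tn pn]]|[Ct [ps [tp pr]]]]] [_ [[n' [tn' pn']]|[Ct' [ps' [tp' pr']]]]].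
  - by rewrite tn tn'; congr (p.1 _); lia.
  - by move: pn pr'; rewrite ps' d0; lia.
  - by move: pn' pr; rewrite ps d0; lia.
  - exact: rhoI tp tp'.
apply: (@card_le_rel _ _ _ _ (fun (tb : T * bool) u =>
  exists p, code tb.1 p /\ u = p.1 (p.2.*2 + tb.2))).
  move=> [t b] [/= At _]; have [p cp] := codeT t At.
  exists (p.1 (p.2.*2 + b)); last by exists p.
  by have [Sp _] := cp; have [] := cS _ _ Sp Sp.
move=> [t b] [t' b'] u _ _ [[s n] [/= cp ->]] [[s' n'] [/= cp' e]].
have [Ss _] := cp; have [Ss' _] := cp'.
have [_ /(_ _ _ e)[/= es en]] := cS _ _ Ss Ss'.
have [en' eb] : n = n' /\ b = b'.
  by clear e; move: b b' en => [] [] /= en; split=> //; lia.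
by subst s' n' b'; rewrite (codeI _ _ _ cp cp').
Qed.

Lemma card_leU_bool T U (A B : set T) (C : set U) :
  A #<= C -> B #<= C -> A `|` B #<= C `*` [set: bool].
Proof.
move=> /card_le_inj[R [RT RI]] /card_le_inj[R' [R'T R'I]].
apply: (@card_le_rel _ _ _ _ (fun x (p : U * bool) =>
  (A x /\ p.2 /\ R x p.1) \/ (~ A x /\ B x /\ p.2 = false /\ R' x p.1))).
  move=> x ABx; have [Ax|nAx] := pselect (A x).
    by have [y Cy xy] := RT x Ax; exists (y, true) => //; left.
  have Bx : B x by case: ABx.
  by have [y Cy xy] := R'T x Bx; exists (y, false) => //; right.
move=> x x' [y b] _ _ [[Ax [/= -> xy]]|[nA [Bx [/= -> xy]]]]
   [[Ax' [//= _ xy']]|[nA' [Bx' [//= _ xy']]]].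
  exact: RI xy xy'.
exact: R'I xy xy'.
Qed.

Lemma card_leU T U (A B : set T) (C : set U) :
  infinite_set C -> A #<= C -> B #<= C -> A `|` B #<= C.
Proof.
by move=> infC lAC lBC; apply: card_le_trans (card_leU_bool lAC lBC) (card_le_setM_bool infC).
Qed.

Lemma card_geU T U (A B : set T) (C : set U) :
  infinite_set C -> C #<= A `|` B -> C #<= A \/ C #<= B.
Proof.
move=> infC.
wlog AB : A B / A #<= B.
  move=> W CAB; case: (card_le_total A B) => h; first exact: W.
  by case: (W B A h); [rewrite setUC|right|left].
move=> CAB; right; apply: card_le_trans (CAB) _; apply: card_leU => //.
move=> finB; apply: infC; apply: card_le_finite (CAB) _.
by rewrite finite_setU; split=> //; apply: card_le_finite AB finB.
Qed.

Lemma card_leU_seq (I : eqType) T U (F : I -> set T) (C : set U) (l : seq I) :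
  infinite_set C -> (forall i, i \in l -> F i #<= C) ->
  [set x | exists2 i, i \in l & F i x] #<= C.
Proof.
move=> infC; elim: l => [|i l IH] H.
  by rewrite (_ : mkset _ = set0) ?card_ge0 //; apply/seteqP; split=> // x [].
rewrite (_ : mkset _ = F i `|` [set x | exists2 i, i \in l & F i x]); last first.
  apply/seteqP; split=> x.
    by move=> [j]; rewrite inE => /predU1P[-> ?|jl ?]; [left|right; exists j].
  by case=> [?|[j jl ?]]; [exists i|exists j] => //; rewrite inE ?eqxx ?jl ?orbT.
apply: card_leU => //; first by apply: H; rewrite mem_head.
by apply: IH => j jl; apply: H; rewrite inE jl orbT.
Qed.

Lemma card_geU_seq (I : eqType) T U (F : I -> set T) (C : set U) (l : seq I) :
  infinite_set C -> C #<= [set x | exists2 i, i \in l & F i x] ->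
  exists2 i, i \in l & C #<= F i.
Proof.
move=> infC; elim: l => [|i l IH] H.
  exfalso; apply: infC; apply: card_le_finite H _.
  by rewrite (_ : mkset _ = set0) //; apply/seteqP; split=> // x [].
have /(card_geU infC)[h|/IH[j jl h]] : C #<= F i `|` [set x | exists2 i, i \in l & F i x].
- apply: card_le_trans H (subset_card_le _) => x [j].
  by rewrite inE => /predU1P[-> ?|jl ?]; [left|right; exists j].
- by exists i; rewrite ?mem_head.
- by exists j; rewrite // inE jl orbT.
Qed.

Lemma wf_of_minimal T (R : T -> T -> Prop) :
  (forall X : set T, X !=set0 -> exists2 x, X x & forall y, X y -> ~ R y x) ->
  well_founded R.
Proof.
move=> H x; apply: contrapT => nx.
have [|y ny ymin] := H [set x | ~ Acc R x]; first by exists x.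
by apply: ny; constructor => z zy; apply: contrapT => nz; apply: (ymin z).
Qed.

Lemma wf_minimal T (R : T -> T -> Prop) (X : set T) :
  well_founded R -> X !=set0 -> exists2 x, X x & forall y, X y -> ~ R y x.
Proof.
move=> wf [x Xx]; apply: contrapT => nX.
elim/(well_founded_ind wf): x Xx => x IH Xx.
by apply: nX; exists x => // y Xy yx; apply: IH yx Xy.
Qed.

(** The strict part is taken as the negation of the converse, which is the same
    for a total order. *)
Lemma strict_well_order T : exists2 R : T -> T -> Prop,
  well_founded R & forall x y, x <> y -> R x y \/ R y x.
Proof.
have [W WP] := well_ordering_principle {classic T}.
have minX (X : set T) : X !=set0 ->
    exists2 z, X z & (forall y, X y -> W z y) /\
      forall z', X z' -> (forall y, X y -> W z' y) -> z = z'.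
  move=> [x0 Xx0]; have [|z [[/asboolP Xz zmin] zuniq]] :=
    WP (fun x : {classic T} => `[< X x >]); first by exists x0; apply/asboolP.
  exists z => //; split=> [y Xy|z' Xz' z'min]; first by apply: zmin; apply/asboolP.
  by apply: zuniq; split=> [|y /asboolP]; [apply/asboolP|apply: z'min].
have Wxx x : W x x.
  by have [z <- [zmin _]] := minX [set x] (ex_intro _ x erefl); apply: zmin.
exists (fun x y => ~ W y x).
  apply: wf_of_minimal => X /minX[z Xz [zmin _]]; exists z => // y Xy.
  by apply; apply: zmin.
move=> x y xy; have [Wyx|] := pselect (W y x); last by left.
right=> Wxy; apply: xy.
have [|z _ [_ zu]] := minX [set x; y]; first by exists x; left.
rewrite -(zu x) ?(zu y) //=; [by right|by move=> t [->|->]|by left|].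
by move=> t [->|->].
Qed.

(** The order type is the initial ordinal of [S]: if a well-order has an initial
    segment as large as [S], transport the order of the least such segment. *)
Lemma initial_well_order T (S : set T) : exists R : T -> T -> Prop,
  [/\ well_founded R,
      forall x y, S x -> S y -> x <> y -> R x y \/ R y x &
      forall y, S y -> ~ (S #<= [set x | S x /\ R x y])].
Proof.
have [W wfW totW] := strict_well_order T.
pose seg y := [set x | S x /\ W x y].
have [Hi|nseg] := pselect ([set i | S i /\ S #<= seg i] !=set0); last first.
  exists W; split=> // [x y _ _|y Sy le]; first exact: totW.
  by apply: nseg; exists y.
have [i [Si /card_le_inj[phi [phiT phiI]]] imin] := wf_minimal wfW Hi.
have [f fP] := choice_on2 i phiT.
have fI x y : S x -> S y -> f x = f y -> x = y.
  move=> Sx Sy e; apply: (phiI x y (f x)) => //; first by have [] := fP x Sx.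
  by rewrite e; have [] := fP y Sy.
exists (fun x y => W (f x) (f y)); split.
- apply: wf_of_minimal => X [x Xx].
  have [|_ [z Xz <-] zmin] := wf_minimal (X := f @` X) wfW; first by exists (f x), x.
  by exists z => // y Xy; apply: zmin; exists y.
- by move=> x y Sx Sy xy; apply: totW => /fI e; apply: xy; apply: e.
move=> y Sy le; have [[Sfy Wfy] _] := fP y Sy.
apply: (imin (f y)) => //; split=> //; apply: card_le_trans le _.
apply: (@card_le_rel _ _ _ _ (fun x z => f x = z)).
  by move=> x [Sx Wx]; exists (f x) => //; split=> //; have [[]] := fP x Sx.
by move=> x x' z [Sx _] [Sx' _] <- /esym; apply: fI.
Qed.

(** * Transversals, finite and infinite *)

Section Hall.
Variables I J : eqType.
Implicit Types (N : I -> set J) (s : seq I).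

(** [k] neighbours are listed explicitly, so that infinite neighbourhoods are
    covered by counting in finite lists. *)
Definition enough N s k : Prop := exists t : seq J,
  [/\ uniq t, k <= size t & forall j, j \in t -> exists2 i, i \in s & N i j].

(** If [s] has at most [k] neighbours, deleting them leaves [k'] of any
    [k + k'] neighbours of a larger set. *)
Lemma enough_outside N s s' k k' : ~ enough N s k.+1 -> enough N (s ++ s') (k + k') ->
  enough (fun i j => N i j /\ ~ exists2 i', i' \in s & N i' j) s' k'.
Proof.
move=> tight [t [ut kt tP]].
pose inN j := `[< exists2 i, i \in s & N i j >].
exists [seq j <- t | ~~ inN j]; split; first exact: filter_uniq.
- have /negP : ~ (k < size [seq j <- t | inN j]).
    move=> h; apply: tight; exists [seq j <- t | inN j].
    split=> // [|j]; first exact: filter_uniq.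
    by rewrite mem_filter => /andP[/asboolP].
  have : size [seq j <- t | inN j] + size [seq j <- t | ~~ inN j] = size t.
    by rewrite !size_filter -(count_predC inN t).
  by move: kt; lia.
- move=> j; rewrite mem_filter => /andP[/asboolPn nj jt].
  have [i] := tP j jt; rewrite mem_cat => /orP[si Nij|si Nij]; last by exists i.
  by case: nj; exists i.
Qed.

(** The induction of Halmos and Vaughan: either some proper nonempty part is
    tight, and it is matched separately from the rest, or one element may be
    matched arbitrarily. *)
Lemma Hall_marriage (j0 : J) N s : uniq s ->
  (forall s', uniq s' -> {subset s' <= s} -> enough N s' (size s')) ->
  exists h : I -> J, {in s &, injective h} /\ forall i, i \in s -> N i (h i).
Proof.
have [n] := ubnP (size s); elim: n N s => // n IH N s; rewrite ltnS => sn us hall.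
have [[s' [us' s's s'0 s'n tight]]|ntight] := pselect (exists s', [/\ uniq s',
    {subset s' <= s}, s' != [::], size s' < size s & ~ enough N s' (size s').+1]).
  have [||h1 [h1I h1N]] := IH N s' _ us'; first by lia.
    by move=> s'' us'' ss; apply: hall => // i /ss/s's.
  pose s2 := [seq i <- s | i \notin s'].
  have [|||h2 [h2I h2N]] := IH (fun i j => N i j /\ ~ exists2 i', i' \in s' & N i' j) s2.
  - apply: leq_trans sn; rewrite size_filter ltn_neqAle count_size andbT -all_count.
    case: (s') s'0 s's => // a r _ /(_ a); rewrite mem_head => /(_ isT) sa.
    by apply/negP => /allP/(_ a sa); rewrite mem_head.
  - exact: filter_uniq.
  - move=> s'' us'' ss; apply: (enough_outside tight); rewrite -size_cat; apply: hall.
      rewrite cat_uniq us' us'' andbT; apply/hasPn => i /ss.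
      by rewrite mem_filter => /andP[].
    by move=> i; rewrite mem_cat => /orP[/s's//|/ss]; rewrite mem_filter => /andP[].
  have cross i i' : i \in s' -> i' \in s -> i' \notin s' -> h1 i <> h2 i'.
    move=> si si' ni e; have [|_] := h2N i'; first by rewrite mem_filter ni.
    by apply; exists i => //; rewrite -e; apply: h1N.
  exists (fun i => if i \in s' then h1 i else h2 i); split; last first.
    move=> i si; case: ifPn => [/h1N//|ni].
    by have [|] := h2N i; first by rewrite mem_filter ni.
  move=> i i' si si'; case: ifPn => ci; case: ifPn => ci'.
  - exact: h1I.
  - by move/(cross _ _ ci si' ci').
  - by move/esym/(cross _ _ ci' si ci).
  - by apply: h2I; rewrite mem_filter ?ci ?ci'.
case: s => [|a s] in sn us hall ntight *; first by exists (fun=> j0).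
have /andP[nas us1] := us.
have [|[|j t] [//= _ _ /(_ j)]] := hall [:: a] isT.
  by move=> i; rewrite inE => /eqP->; rewrite mem_head.
rewrite mem_head => /(_ isT)[b]; rewrite inE => /eqP-> Naj.
have [||h [hI hN]] := IH (fun i k => N i k /\ k <> j) s _ us1; first exact: sn.
  move=> s' us' ss; have [->|s'0] := eqVneq s' [::]; first by exists [::].
  have [t' [ut' st' t'P]] : enough N s' (size s').+1.
    apply: contrapT => nen; apply: ntight; exists s'; split=> //.
      by move=> i /ss si; rewrite inE si orbT.
    by rewrite ltnS; apply: uniq_leq_size.
  exists (rem j t'); split; first exact: rem_uniq.
    by have [jt'|/rem_id->] := boolP (j \in t'); rewrite ?size_rem //; move: st'; lia.
  move=> k; rewrite mem_rem_uniq // inE => /andP[/eqP kj /t'P[i si Nik]].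
  by exists i.
exists (fun i => if i == a then j else h i); split; last first.
  by move=> i; rewrite inE; case: eqP => [->//|_ /= /hN[]].
have cross i : i \in s -> h i <> j by move=> /hN[].
move=> i i'; rewrite !inE; case: (eqVneq i a) => [->|_]; case: (eqVneq i' a) => [->|_] //=.
- by move=> _ /cross h' /esym.
- by move=> /cross h' _ /h'.
- exact: hI.
Qed.
End Hall.

(** Transfinite recursion along [R]: the values already taken when [i] comes are
    indexed by the predecessors of [i], too few to exhaust [N i].  The elements
    of [P] are matched in advance by [h0] and precede all others. *)
Lemma greedy_transversal I J (N : I -> set J) (R : I -> I -> Prop)
    (P : set I) (h0 : I -> J) :
  well_founded R ->
  (forall i i', P i -> P i' -> h0 i = h0 i' -> i = i') ->
  (forall i i', i <> i' -> ~ (P i /\ P i') -> (R i i' /\ ~ P i') \/ (R i' i /\ ~ P i)) ->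
  (forall i, P i -> N i (h0 i)) ->
  (forall i, ~ P i -> ~ (N i #<= [set i' | R i' i])) ->
  exists h : I -> J, injective h /\ forall i, N i (h i).
Proof.
move=> wf h0I tot h0N big.
have [[i0]|nI] := pselect (inhabited I); last first.
  by exists h0; split=> i; case: nI.
have [G GP] : exists G : set J -> J, forall S, (exists j, S j) -> S (G S).
  exact: (choice_on (R := fun (S : set J) j => S j) (h0 i0)).
pose F i (rec : forall i', R i' i -> J) : J :=
  if pselect (P i) then h0 i else
  G [set j | N i j /\ forall i' (r : R i' i), rec i' r <> j].
pose h := Fix wf (fun=> J) F.
have hE i : h i = F i (fun i' _ => h i').
  rewrite /h Fix_eq // => x f g fg; have -> // : f = g.
  by apply: functional_extensionality_dep => y; apply: funext => r; apply: fg.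
have hP i : P i -> h i = h0 i by move=> Pi; rewrite hE /F; case: pselect.
have hnP i : ~ P i -> N i (h i) /\ forall i', R i' i -> h i' <> h i.
  move=> nPi.
  have -> : h i = G [set j | N i j /\ forall i', R i' i -> h i' <> j].
    by rewrite hE /F; case: pselect.
  apply: (GP [set j | N i j /\ forall i', R i' i -> h i' <> j]).
  apply: contrapT => nj; apply: (big i nPi).
  apply: (@card_le_rel _ _ _ _ (fun j i' => h i' = j)).
    move=> j Nj; apply: contrapT => ni'; apply: nj; exists j; split=> // i' r e.
    by apply: ni'; exists i'.
  by move=> j j' i' _ _ <- <-.
exists h; split=> [i i' e|i]; last first.
  by have [Pi|/hnP[]//] := pselect (P i); rewrite hP //; apply: h0N.
apply: contrapT => ne; have [[Pi Pi']|nPP] := pselect (P i /\ P i').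
  by apply: ne; apply: h0I => //; rewrite -!hP.
by have [[r /hnP[_ /(_ _ r)]]|[r /hnP[_ /(_ _ r)]]] := tot i i' ne nPP; rewrite e.
Qed.

(** Otherwise one could go on choosing elements above none of the previous
    ones. *)
Lemma finite_basis (I : eqType) (P : set I) (r : I -> I -> Prop) :
  (forall u : nat -> I, (forall n, P (u n)) -> exists i j, i < j /\ r (u i) (u j)) ->
  exists l : seq I, (forall i, i \in l -> P i) /\
    forall i, P i -> exists2 k, k \in l & r k i.
Proof.
move=> wqo; apply: contrapT => nb.
have [[i0 _]|nI] := pselect (exists i, P i); last first.
  by apply: nb; exists [::]; split=> // i Pi; case: nI; exists i.
have [F FP] : exists F : seq I -> I, forall l, (forall i, i \in l -> P i) ->
    P (F l) /\ forall k, k \in l -> ~ r k (F l).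
  apply: (choice_on (R := fun l i => P i /\ forall k, k \in l -> ~ r k i) i0) => l lP.
  apply: contrapT => ni; apply: nb; exists l; split=> // i Pi.
  apply: contrapT => nk; apply: ni; exists i; split=> // k kl rk.
  by apply: nk; exists k.
pose As := fix As k := if k is k'.+1 then rcons (As k') (F (As k')) else [::].
have AsP k : forall i, i \in As k -> P i.
  elim: k => // k IH i /=; rewrite mem_rcons inE => /predU1P[->|/IH//].
  by have [] := FP _ IH.
have AsF i k : i < k -> F (As i) \in As k.
  elim: k => // k IH; rewrite ltnS leq_eqVlt /= mem_rcons inE => /predU1P[->|/IH->].
    by rewrite eqxx.
  by rewrite orbT.
have [|i [j [ij]]] := wqo (fun k => F (As k)).
  by move=> n; have [] := FP _ (AsP n).
by have [_] := FP _ (AsP j); apply; apply: AsF.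
Qed.

(** * Families under injective domination *)

Lemma card_le_minimal I T (m : I -> set T) (X : set I) :
  X !=set0 -> exists2 x, X x & forall y, X y -> m x #<= m y.
Proof.
move=> [x Xx].
have [[k Xk] kmin] := card_le_min (fun y : {i | X i} => m (sval y)) (exist _ x Xx).
by exists k => // y Xy; apply: (kmin (exist _ y Xy)).
Qed.

(** For families over a better-quasi-order, domination along an injection is
    decided by cardinalities: it suffices that every upward closed set has at
    least as many indices in the second family as in the first.  This replaces
    a minimal bad sequence argument for (possibly infinite) multisets. *)
Theorem family_domination (I J : eqType) T (Q : T -> Prop) (le : T -> T -> Prop)
    (f : I -> T) (g : J -> T) :
  (forall x, le x x) -> (forall y x z, le x y -> le y z -> le x z) ->
  simpson_bqo Q le -> (forall i, Q (f i)) -> (forall j, Q (g j)) ->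
  (forall X : T -> Prop, (forall x, X x -> Q x) -> (forall x y, Q y -> X x -> le x y -> X y) ->
     [set i | X (f i)] #<= [set j | X (g j)]) ->
  exists h : I -> J, injective h /\ forall i, le (f i) (g (h i)).
Proof.
move=> le_refl le_trans bQ Qf Qg fg.
pose up i := [set i' | le (f i) (f i')].
pose N i := [set j | le (f i) (g j)].
have upii i : up i i by apply: le_refl.
have up_trans i k : up i k -> up k `<=` up i.
  by move=> ik j; apply: (le_trans _ _ _ ik).
have upN i : up i #<= N i.
  pose X x := Q x /\ le (f i) x.
  have /card_le_inj[R [RT RI]] : [set k | X (f k)] #<= [set j | X (g j)].
    apply: fg; first by move=> x [].
    by move=> x y Qy [Qx ix] xy; split=> //; apply: (le_trans _ _ _ ix xy).
  apply: (@card_le_rel _ _ _ _ R).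
    by move=> x ix; have [|y [_ iy] xy] := RT x; [split|exists y].
  by move=> x x' y ix ix' xy xy'; apply: (RI _ _ y) => //; split.
have basis (P : set I) : exists l : seq I, (forall i, i \in l -> P i) /\
    P `<=` [set i | exists2 k, k \in l & up k i].
  apply: finite_basis => u Pu.
  exact: (simpson_bqo_wqo (u := fun n => f (u n)) bQ).
(* the indices with only finitely many indices above them are finite in number
   and are matched first, by Hall's theorem *)
pose P := [set i | finite_set (up i)].
have finP : finite_set P.
  apply: contrapT => /infiniteP natP; have [l [lP Pl]] := basis P.
  have [k kl] := card_geU_seq infinite_nat (card_le_trans natP (subset_card_le Pl)).
  by move=> /infiniteP; apply; apply: lP.
have [[i0]|nI] := pselect (inhabited I); last first.
  by exists (fun i => False_rect J (nI (inhabits i))); split=> i; case: nI.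
have [j0 _] : N i0 !=set0.
  have [R [RT _]] := card_le_inj (upN i0).
  by have [j] := RT i0 (upii i0); exists j.
have [h0 [h0I h0N]] : exists h0 : I -> J,
    (forall i i', P i -> P i' -> h0 i = h0 i' -> i = i') /\ (forall i, P i -> N i (h0 i)).
  have /finite_seqP[s sP] := finP.
  have [|h [hI hN]] := @Hall_marriage I J j0 N (undup s) (undup_uniq s).
    move=> s' us' _.
    pose X x := Q x /\ exists2 i, i \in s' & le (f i) x.
    have /card_le_inj[R [RT RI]] : [set k | X (f k)] #<= [set j | X (g j)].
      apply: fg; first by move=> x [].
      move=> x y Qy [Qx [i si ix]] xy; split=> //; exists i => //.
      by apply: (le_trans _ _ _ ix xy).
    have si_up i : i \in s' -> X (f i).
      by move=> si; split=> //; exists i => //; apply: le_refl.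
    have [phi phiP] := choice_on2 (P := fun i => i \in s') j0 (fun i si => RT i (si_up i si)).
    exists (map phi s'); split; last 1 first.
    - move=> _ /mapP[i si ->].
      by have [[_ [i' si' ii']] _] := phiP i si; exists i'.
    - rewrite map_inj_in_uniq // => i i' si si' e.
      apply: (RI _ _ (phi i)); [exact: si_up|exact: si_up| |].
        by have [] := phiP i si.
      by rewrite e; have [] := phiP i' si'.
    by rewrite size_map.
  have Ps i : P i -> i \in undup s by rewrite sP mem_undup.
  by exists h; split=> [i i' /Ps si /Ps si'|i /Ps si]; [apply: hI|apply: hN].
(* The other indices are treated by increasing cardinality of up i and, within
   one cardinality class, along a well-order with small initial segments.  Below
   i there are then fewer than |up i| indices: they form a finite union of sets,
   each given by one basis element and each smaller than up i, together with an
   initial segment of the class. *)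
pose cl i := [set i' | up i' #<= up i /\ up i #<= up i'].
have [W WP] := choice (fun S : set I => initial_well_order S).
pose R i' i := ~ (up i #<= up i') \/ (cl i i' /\ W (cl i) i' i).
have clE i i' : cl i i' -> cl i = cl i'.
  move=> [ii' i'i]; apply/seteqP; split=> k [ki ik]; split.
  - exact: card_le_trans ki i'i.
  - exact: card_le_trans ii' ik.
  - exact: card_le_trans ki ii'.
  - exact: card_le_trans i'i ik.
have clii i : cl i i by split; apply: card_lexx.
have wfR : well_founded R.
  apply: wf_of_minimal => X [x Xx].
  have [y Xy ymin] := card_le_minimal up (ex_intro _ x Xx).
  have [wfW _ _] := WP (cl y).
  have [|z [Xz clz] zmin] := wf_minimal (X := X `&` cl y) wfW; first by exists y.
  exists z => // t Xt [h|[clt Wt]].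
    by apply: h; apply: card_le_trans (ymin t Xt); case: clz.
  rewrite -(clE _ _ clz) in clt Wt.
  by apply: (zmin t).
apply: (greedy_transversal (R := R) (P := P) wfR h0I _ h0N).
  move=> i i' ne nPP.
  have small k k' : P k -> ~ P k' -> R k k'.
    by move=> Pk nPk'; left => h; apply: nPk'; apply: card_le_finite h Pk.
  have [Pi|nPi] := pselect (P i).
    by left; split; [apply: small|] => // Pi'; apply: nPP.
  have [Pi'|nPi'] := pselect (P i'); first by right; split=> //; apply: small.
  have [h1|h1] := pselect (up i #<= up i'); last by right; split=> //; left.
  have [h2|h2] := pselect (up i' #<= up i); last by left; split=> //; left.
  have cli : cl i i' by split.
  have [_ /(_ i i' (clii i) cli ne)[h|h] _] := WP (cl i).
    by left; split=> //; right; rewrite -(clE _ _ cli); split=> //; apply: clii.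
  by right; split=> //; right.
move=> i nPi /(card_le_trans (upN i)) h.
pose P1 := [set i' | ~ (up i #<= up i')].
pose P2 := [set i' | cl i i' /\ W (cl i) i' i].
have : up i #<= P1 `|` P2 by apply: card_le_trans h (subset_card_le _) => i' [?|?]; [left|right].
move=> /(card_geU nPi)[h1|h2].
  have [l [lP Pl]] := basis P1.
  have [k /lP nk] := card_geU_seq nPi (card_le_trans h1 (subset_card_le Pl)).
  exact: nk.
have [_ _ /(_ i (clii i))] := WP (cl i); apply; apply: card_le_trans h2.
have [l [lP Pl]] := basis (cl i).
apply: card_le_trans (subset_card_le Pl) (card_leU_seq nPi _).
by move=> k /lP[].
Qed.

Record family T := Family { index : Type; member : index -> T }.
Arguments member {T} f i.

Definition family_le T (le : T -> T -> Prop) (F G : family T) : Prop :=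
  exists h : index F -> index G,
    injective h /\ forall i, le (member F i) (member G (h i)).

(** A cardinal number is represented by any set of that cardinality. *)
Record cardinal := Cardinal { carrier : Type; extent : set carrier }.
Arguments extent : clear implicits.

Definition cardinal_le (c d : cardinal) : Prop := extent c #<= extent d.

Lemma simpson_bqo_cardinal : simpson_bqo (fun=> True) cardinal_le.
Proof.
apply: simpson_bqo_seq => u _.
have [n nmin] := card_le_min (fun n => extent (u n)) 0.
by exists n; apply: nmin.
Qed.

(** A family is encoded by the set of all pairs of an upward closed set and the
    number of its members there, compared by domination; upward closed sets are
    compared by reverse inclusion, which is the order [refines] on them. *)
Theorem simpson_bqo_family T (Q : T -> Prop) (le : T -> T -> Prop) :
  (forall x, le x x) -> (forall y x z, le x y -> le y z -> le x z) ->
  simpson_bqo Q le ->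
  simpson_bqo (fun F => forall i, Q (member F i)) (family_le le).
Proof.
move=> le_refl le_trans bQ.
have := simpson_bqo_dominated (simpson_bqo_prod (simpson_bqo_refines bQ) simpson_bqo_cardinal).
pose upset (X : T -> Prop) := (forall x, X x -> Q x) /\ forall x y, Q y -> X x -> le x y -> X y.
pose profile (F : family T) (p : (T -> Prop) * cardinal) : Prop :=
  exists2 X, upset X & p = (X, Cardinal [set i | X (member F i)]).
apply: (simpson_bqo_reflect (code := fun F p => p = profile F)).
  by move=> F _; exists (profile F) => // _ [X [XQ _] ->].
move=> [I f] [J g] _ _ Qf Qg -> -> FG.
apply: (@family_domination {classic I} {classic J} T Q le f g) => // X XQ Xup.
have [|_ [Y [YQ Yup] ->] [/= XY c]] := FG (X, Cardinal [set i | X (f i)]).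
  by exists X.
apply: card_le_trans c (subset_card_le _) => j /= /XY[x Xx xj].
exact: Xup xj.
Qed.

(** * Weighted graphs of bounded depth *)

Section Walks.
Variables (V : Type) (a : V -> V -> Prop).
Implicit Types D : set V.

Inductive conn D (u : V) : V -> Prop :=
| conn_refl : D u -> conn D u u
| conn_step v w : conn D u v -> a v w -> D w -> conn D u w.

(** A path of [n] edges that starts at [r]: deleting the vertices already
    visited makes it self-avoiding. *)
Fixpoint has_path n D (r : V) : Prop :=
  D r /\ if n is n'.+1 then exists2 v, a r v & has_path n' (D `\ r) v else True.

Lemma conn_domr D u v : conn D u v -> D v. Proof. by case. Qed.

Lemma conn_doml D u v : conn D u v -> D u. Proof. by elim. Qed.

Lemma conn_trans D u v w : conn D u v -> conn D v w -> conn D u w.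
Proof.
move=> uv; elim=> // x y _ ux xy Dy; exact: conn_step ux xy Dy.
Qed.

Lemma conn_sym D u v : (forall x y, a x y -> a y x) -> conn D u v -> conn D v u.
Proof.
move=> aC; elim=> [Du|x y ux xu xy Dy]; first exact: conn_refl.
by apply: conn_trans xu; apply: conn_step (aC _ _ xy) _;
  [apply: conn_refl|apply: conn_domr ux].
Qed.

Lemma conn_component D u v : conn D u v -> conn [set w | conn D u w] u v.
Proof.
elim=> [Du|x y ux uxC xy Dy]; first by apply: conn_refl; apply: conn_refl.
by apply: (conn_step uxC xy); apply: conn_step ux xy Dy.
Qed.

Lemma has_path_sub n D D' r : D `<=` D' -> has_path n D r -> has_path n D' r.
Proof.
elim: n D D' r => [|n IH] D D' r sub /= [Dr]; first by split=> //; apply: sub.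
move=> [v rv vp]; split; first exact: sub.
by exists v => //; apply: IH vp => w [/sub D'w nr].
Qed.

(** Follow a walk from [r] after its last visit to [r]. *)
Lemma conn_exit D r v : conn D r v -> v <> r ->
  exists2 x, a r x & conn (D `\ r) x v.
Proof.
elim=> [//|x y rx IH xy Dy yr].
have [xr|xr] := pselect (x = r).
  by exists y; [rewrite -xr|apply: conn_refl].
have [z rz zx] := IH xr.
by exists z => //; apply: conn_step zx xy _.
Qed.
End Walks.

(** Graphs with weights on pairs of vertices and labels on vertices.  Weights
    stand for the sets of parallel edges, and labels record the weights towards
    vertices already deleted.  The domain [wdom] makes deletions and components
    change only a set, and [wpoint] gives a default value for maps into the
    vertices. *)
Record wgraph M L := WGraph {
  wvert : Type;
  wpoint : wvert;
  wdom : set wvert;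
  weight : wvert -> wvert -> M;
  label : wvert -> L }.
Arguments wpoint {M L} _.
Arguments wdom {M L} _ _.
Arguments weight {M L} _ _ _.
Arguments label {M L} _ _.

Section WeightedGraphs.
Variables (M : Type) (QM : M -> Prop) (leM : M -> M -> Prop) (Z : M -> Prop).
Hypothesis leM_refl : forall m, leM m m.
Hypothesis leM_trans : forall m1 m0 m2, leM m0 m1 -> leM m1 m2 -> leM m0 m2.
Hypothesis bqoM : simpson_bqo QM leM.
Hypothesis leZ : forall m m', Z m -> Z m' -> leM m m'.

Definition adj L (G : wgraph M L) (u v : wvert G) : Prop := ~ Z (weight G u v).
Arguments adj {L} G u v.

Definition wgraph_le L (leL : L -> L -> Prop) (G G' : wgraph M L) : Prop :=
  exists h : wvert G -> wvert G',
    [/\ forall u, wdom G u -> wdom G' (h u),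
        forall u v, wdom G u -> wdom G v -> h u = h v -> u = v,
        forall u, wdom G u -> leL (label G u) (label G' (h u)) &
        forall u v, wdom G u -> wdom G v ->
          leM (weight G u v) (weight G' (h u) (h v))].

Lemma wgraph_le_refl L leL (G : wgraph M L) :
  (forall l, leL l l) -> wgraph_le leL G G.
Proof. by move=> rL; exists id; split. Qed.

Lemma wgraph_le_trans L leL (G1 G0 G2 : wgraph M L) :
  (forall y x z, leL x y -> leL y z -> leL x z) ->
  wgraph_le leL G0 G1 -> wgraph_le leL G1 G2 -> wgraph_le leL G0 G2.
Proof.
move=> tL [h [hD hI hL hW]] [k [kD kI kL kW]]; exists (k \o h); split=> /=.
- by move=> u /hD/kD.
- by move=> u v Du Dv /kI e; apply: hI => //; apply: e; apply: hD.
- by move=> u Du; apply: tL (hL u Du) (kL _ (hD u Du)).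
- by move=> u v Du Dv; apply: leM_trans (hW u v Du Dv) (kW _ _ (hD u Du) (hD v Dv)).
Qed.

Definition valid L (QL : L -> Prop) (G : wgraph M L) : Prop :=
  [/\ forall u v, weight G u v = weight G v u,
      forall u v, wdom G u -> wdom G v -> QM (weight G u v) &
      forall u, wdom G u -> QL (label G u)].

(** Every component has a root from which no path of [n] edges starts.  This is
    a rooted form of tree-depth. *)
Definition depth_le L QL n (G : wgraph M L) : Prop :=
  valid QL G /\ forall v, wdom G v -> exists r,
    conn (adj G) (wdom G) r v /\ ~ has_path (adj G) n (wdom G) r.

Definition rooted_at L n (G : wgraph M L) (r : wvert G) : Prop :=
  [/\ wdom G r, forall v, wdom G v -> conn (adj G) (wdom G) r v &
      ~ has_path (adj G) n (wdom G) r].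
Arguments rooted_at {L} n G r.

Definition rooted_depth_le L QL n (G : wgraph M L) : Prop :=
  valid QL G /\ exists r, rooted_at n G r.

Lemma adjC L QL (G : wgraph M L) u v : valid QL G -> adj G u v -> adj G v u.
Proof. by move=> [wC _ _]; rewrite /adj wC. Qed.

Definition delete L (G : wgraph M L) (r : wvert G) : wgraph M (L * M) :=
  WGraph (wpoint G) (wdom G `\ r) (weight G)
         (fun v => (label G v, weight G r v)).
Arguments delete {L} G r.

(** Delete the root and remember in the labels how each vertex was joined to it.
    A component of the rest contains a neighbour [x] of the root, and a path from
    [x] prolongs to a path from the root with one edge more. *)
Lemma rooted_bqo L QL (leL : L -> L -> Prop) n :
  simpson_bqo QL leL ->
  simpson_bqo (depth_le (fun p : L * M => QL p.1 /\ QM p.2) n)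
    (wgraph_le (fun p q : L * M => leL p.1 q.1 /\ leM p.2 q.2)) ->
  simpson_bqo (rooted_depth_le QL n.+1) (wgraph_le leL).
Proof.
move=> bL bD.
have := simpson_bqo_prod (simpson_bqo_prod bL bqoM) bD.
apply: (simpson_bqo_reflect (code := fun G y => exists r,
  rooted_at n.+1 G r /\ y = (label G r, weight G r r, delete G r))).
  move=> G [[wC wQ lQ] [r [Dr cr npr]]].
  exists (label G r, weight G r r, delete G r); last by exists r.
  split=> /=; first by split; [apply: lQ|apply: wQ].
  split.
    split=> //= [u v [Du _] [Dv _]|u [Du _]]; first exact: wQ.
    by split; [apply: lQ|apply: wQ].
  move=> v /= [Dv vr]; have [x rx xv] := conn_exit (cr v Dv) vr.
  exists x; split; first exact: xv.
  by move=> xp; apply: npr; split=> //; exists x.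
move=> G G' y y' [[wC _ _] _] [[wC' _ _] _] [r [[Dr _ _] ->]] [r' [[Dr' _ _] ->]].
move=> [/= [lrr wrr] [h [hD hI hL hW]]].
pose k v := if pselect (v = r) then r' else h v.
have kr : k r = r' by rewrite /k; case: pselect.
have kh v : v <> r -> k v = h v by rewrite /k; case: pselect.
exists k; split.
- move=> u Du; have [->|ur] := pselect (u = r); first by rewrite kr.
  by rewrite kh //; have [] := hD u.
- move=> u v Du Dv.
  have [->|ur] := pselect (u = r); have [->|vr] := pselect (v = r) => //.
  + by rewrite kr kh // => e; have [_] := hD v (conj Dv vr); rewrite -e => /(_ erefl).
  + by rewrite kr kh // => e; have [_] := hD u (conj Du ur); rewrite e => /(_ erefl).
  + by rewrite !kh // => e; apply: hI.
- move=> u Du; have [->|ur] := pselect (u = r); first by rewrite kr.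
  by rewrite kh //; have [] := hL u (conj Du ur).
- move=> u v Du Dv.
  have [->|ur] := pselect (u = r); have [->|vr] := pselect (v = r).
  + by rewrite kr.
  + by rewrite kr kh //; have [] := hL v (conj Dv vr).
  + by rewrite wC wC' kr kh //; have [] := hL u (conj Du ur).
  + by rewrite !kh //; apply: hW.
Qed.

Definition component L (G : wgraph M L) (r : wvert G) : wgraph M L :=
  WGraph (wpoint G) [set v | conn (adj G) (wdom G) r v] (weight G) (label G).
Arguments component {L} G r.

(** A choice of one admissible root for each component. *)
Definition rooting L n (G : wgraph M L) (rt : wvert G -> wvert G) : Prop :=
  (forall v, wdom G v -> conn (adj G) (wdom G) (rt v) v /\
     ~ has_path (adj G) n (wdom G) (rt v)) /\
  (forall u v, conn (adj G) (wdom G) u v -> rt u = rt v).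
Arguments rooting {L} n G rt.

Lemma rooting_exists L QL n (G : wgraph M L) :
  depth_le QL n G -> exists rt, rooting n G rt.
Proof.
move=> [vG rG].
have [c cP] := @choice_on (set (wvert G)) (wvert G) (fun S => exists r, S r)
  (fun S r => S r) (wpoint G) (fun S h => h).
pose good v := [set r | conn (adj G) (wdom G) r v /\ ~ has_path (adj G) n (wdom G) r].
exists (fun v => c (good v)); split=> [v Dv|u v uv]; first exact: (cP (good v) (rG v Dv)).
congr c; apply/seteqP; split=> r [rc np]; split=> //.
  exact: conn_trans rc uv.
by apply: conn_trans rc _; apply: conn_sym uv => x y; apply: adjC vG.
Qed.

Definition components L (G : wgraph M L) (rt : wvert G -> wvert G) :
    family (wgraph M L) :=
  @Family _ {r : wvert G | exists2 v, wdom G v & r = rt v} (fun r => component G (sval r)).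
Arguments components {L} G rt.

(** Embeddings of distinct components go to distinct components, and weights
    between distinct components are zero, so the embeddings can be glued. *)
Lemma components_le L (leL : L -> L -> Prop) QL n (G G' : wgraph M L) rt rt' :
  valid QL G -> valid QL G' -> rooting n G rt -> rooting n G' rt' ->
  family_le (wgraph_le leL) (components G rt) (components G' rt') ->
  wgraph_le leL G G'.
Proof.
move=> vG vG' [rtP rtE] [rt'P rt'E] [j [jI jP]].
have /choice[phi phiP] : forall i, exists h : wvert G -> wvert G',
    [/\ forall u, conn (adj G) (wdom G) (sval i) u ->
                  conn (adj G') (wdom G') (sval (j i)) (h u),
        forall u v, conn (adj G) (wdom G) (sval i) u ->
          conn (adj G) (wdom G) (sval i) v -> h u = h v -> u = v,
        forall u, conn (adj G) (wdom G) (sval i) u -> leL (label G u) (label G' (h u)) &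
        forall u v, conn (adj G) (wdom G) (sval i) u ->
          conn (adj G) (wdom G) (sval i) v ->
          leM (weight G u v) (weight G' (h u) (h v))].
  by move=> i; have [h hP] := jP i; exists h.
pose rv v (Dv : wdom G v) : index (components G rt) :=
  exist _ (rt v) (ex_intro2 _ _ v Dv erefl).
have rvE u v (Du : wdom G u) (Dv : wdom G v) : rt u = rt v -> rv u Du = rv v Dv.
  by move=> e; apply: eq_exist.
pose h v := if pselect (wdom G v) is left Dv then phi (rv v Dv) v else wpoint G'.
have hE v (Dv : wdom G v) : h v = phi (rv v Dv) v.
  by rewrite /h; case: pselect => // Dv'; rewrite (rvE _ _ Dv' Dv).
have inC v (Dv : wdom G v) : conn (adj G) (wdom G) (sval (rv v Dv)) v by have [] := rtP v Dv.
have hC v (Dv : wdom G v) : conn (adj G') (wdom G') (sval (j (rv v Dv))) (h v).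
  by rewrite (hE v Dv); have [+ _ _ _] := phiP (rv v Dv); apply.
have rt'j k : rt' (sval (j k)) = sval (j k).
  case: (j k) => r /= [v Dv rE]; rewrite rE.
  by apply: rt'E; have [] := rt'P v Dv.
have sameC u v (Du : wdom G u) (Dv : wdom G v) :
    conn (adj G') (wdom G') (h u) (h v) -> rt u = rt v.
  move=> huv; suff /jI/(congr1 sval) : j (rv u Du) = j (rv v Dv) by [].
  apply: eq_sig_hprop; first by move=> *; apply: Prop_irrelevance.
  have ju : sval (j (rv u Du)) = rt' (h u) by rewrite -(rt'E _ _ (hC u Du)) rt'j.
  have jv : sval (j (rv v Dv)) = rt' (h v) by rewrite -(rt'E _ _ (hC v Dv)) rt'j.
  by rewrite ju jv; apply: rt'E.
exists h; split.
- by move=> u Du; apply: conn_domr (hC u Du).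
- move=> u v Du Dv e.
  have ruv : rt u = rt v.
    by apply: (sameC u v Du Dv); rewrite e; apply: conn_refl; apply: conn_domr (hC v Dv).
  move: e; rewrite (hE u Du) (hE v Dv) (rvE _ _ Du Dv ruv).
  have [_ + _ _] := phiP (rv v Dv); apply; last exact: inC.
  by rewrite -(rvE _ _ Du Dv ruv); apply: inC.
- by move=> u Du; rewrite (hE u Du); have [_ _ + _] := phiP (rv u Du); apply.
- move=> u v Du Dv; have [ruv|nruv] := pselect (rt u = rt v).
    rewrite (hE u Du) (hE v Dv) (rvE _ _ Du Dv ruv).
    have [_ _ _ +] := phiP (rv v Dv); apply; last exact: inC.
    by rewrite -(rvE _ _ Du Dv ruv); apply: inC.
  apply: leZ; apply: contrapT => nz; apply: nruv.
    by apply: rtE; apply: conn_step nz Dv; apply: conn_refl.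
  apply: (sameC u v Du Dv); apply: conn_step nz (conn_domr (hC v Dv)).
  by apply: conn_refl; apply: conn_domr (hC u Du).
Qed.

Lemma depth_bqo_of_rooted L QL (leL : L -> L -> Prop) n :
  (forall l, leL l l) -> (forall y x z, leL x y -> leL y z -> leL x z) ->
  simpson_bqo (rooted_depth_le QL n) (wgraph_le leL) ->
  simpson_bqo (depth_le QL n) (wgraph_le leL).
Proof.
move=> rL tL bR.
have := simpson_bqo_family (fun G => wgraph_le_refl G rL)
  (fun G1 G0 G2 => wgraph_le_trans tL) bR.
apply: (simpson_bqo_reflect (code := fun G F => exists rt,
  rooting n G rt /\ F = components G rt)).
  move=> G DG; have [rt rtG] := rooting_exists DG.
  exists (components G rt); last by exists rt.
  move=> [r [v Dv rE]] /=; have [[wC wQ lQ] _] := DG.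
  have [rtP _] := rtG; have [cv np] := rtP v Dv; rewrite -rE in cv np.
  split.
    split=> //= [u w Cu Cw|u Cu]; first by apply: wQ; [exact: conn_domr Cu|exact: conn_domr Cw].
    exact/lQ/(conn_domr Cu).
  exists r; split=> [|w|hp]; last 2 first.
  - exact: conn_component.
  - by apply: np; apply: has_path_sub hp => w; apply: conn_domr.
  by apply: conn_refl; apply: conn_doml cv.
move=> G G' y y' [vG _] [vG' _] [rt [rtG ->]] [rt' [rtG' ->]].
exact: components_le vG vG' rtG rtG'.
Qed.

(** The statement has to hold for all label orders at once, because deleting a
    root enlarges the labels. *)
Theorem bounded_depth_bqo n : forall L QL (leL : L -> L -> Prop),
  (forall l, leL l l) -> (forall y x z, leL x y -> leL y z -> leL x z) ->
  simpson_bqo QL leL -> simpson_bqo (depth_le QL n) (wgraph_le leL).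
Proof.
elim: n => [|n IH] L QL leL rL tL bL; apply: depth_bqo_of_rooted => //.
  move=> g cg /(_ id incr_id)[_ [r [Dr _ np]]]; exfalso.
  by apply: np; split.
apply: rooted_bqo => //; apply: IH.
- by move=> l; split.
- by move=> y x z [? ?] [? ?]; split; [apply: tL|apply: leM_trans]; eassumption.
- exact: simpson_bqo_prod.
Qed.
End WeightedGraphs.
Arguments adj {M} Z {L} G u v.

(** * Embeddings of graphs and of weighted graphs *)

Lemma joinsC (G : graph) (e : edge G) u v : joins e u v -> joins e v u.
Proof. by case=> e_uv; [right|left]. Qed.

Lemma joins_ends (G : graph) (e : edge G) : joins e (ends e).1 (ends e).2.
Proof. by left; case: (ends e). Qed.

Lemma joins_unique (G : graph) (e : edge G) u v u' v' :
  joins e u v -> joins e u' v' -> (u = u' /\ v = v') \/ (u = v' /\ v = u').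
Proof. by rewrite /joins => -[] -> [] [-> ->]; [left|right|right|left]. Qed.

Definition embedding (X Y : graph) (f : vert X -> vert Y) (g : edge X -> edge Y) : Prop :=
  [/\ injective f, injective g &
      forall e u v, joins e u v -> joins (g e) (f u) (f v)].

Lemma bijective_of_surjective T U (f : T -> U) :
  injective f -> (forall y, exists x, f x = y) -> bijective f.
Proof.
by move=> fI /choice[h hP]; exists h => // x; apply: fI; rewrite hP.
Qed.

Lemma sval_inj T (P : T -> Prop) : injective (@sval T P).
Proof. by move=> u v; apply: eq_sig_hprop => x p q; apply: Prop_irrelevance. Qed.

Lemma subgraph_leE (X Y : graph) :
  subgraph_le X Y -> exists f g, @embedding X Y f g.
Proof.
move=> [S [f [g [/bij_inj fI /bij_inj gI fg]]]].
exists (fun v => sval (f v)), (fun e => sval (g e)); split.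
- by move=> u v /sval_inj/fI.
- by move=> u v /sval_inj/gI.
- move=> e u v /fg [] E; [left|right]; rewrite [LHS]surjective_pairing.
    exact: (congr1 (fun p => (sval p.1, sval p.2)) E).
  exact: (congr1 (fun p => (sval p.1, sval p.2)) E).
Qed.

Section SubgraphOfEmbedding.
Variables (X Y : graph) (f : vert X -> vert Y) (g : edge X -> edge Y).
Hypothesis fg : embedding f g.

Lemma image_ends d : (exists e, g e = d) ->
  (exists u, f u = (ends d).1) /\ (exists u, f u = (ends d).2).
Proof.
move=> [e <-]; have [_ _ J] := fg.
have [->|->] /= := J _ _ _ (joins_ends e).
  by split; [exists (ends e).1|exists (ends e).2].
by split; [exists (ends e).2|exists (ends e).1].
Qed.

Definition image_subgraph : subgraph Y :=
  Subgraph (fun v => exists u, f u = v) (fun d => exists e, g e = d) image_ends.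

Lemma image_subgraph_iso : graph_iso X (graph_of image_subgraph).
Proof.
have [fI gI J] := fg.
exists (fun u => exist _ (f u) (ex_intro _ u erefl)).
exists (fun e => exist _ (g e) (ex_intro _ e erefl)); split.
- apply: bijective_of_surjective => [u v /(congr1 sval)/fI//|[v [u uv]]].
  by exists u; apply: sval_inj.
- apply: bijective_of_surjective => [u v /(congr1 sval)/gI//|[v [u uv]]].
  by exists u; apply: sval_inj.
move=> e u v /J; rewrite /joins /= => J'.
by case: J' => E; [left|right]; congr (_, _); apply: sval_inj; rewrite /= E.
Qed.

Lemma subgraph_le_of_embedding : subgraph_le X Y.
Proof. by exists image_subgraph; apply: image_subgraph_iso. Qed.

Lemma induced_subgraph_le_of_embedding :
  (forall d u v, joins d (f u) (f v) -> exists e, g e = d) ->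
  induced_subgraph_le X Y.
Proof.
move=> full; exists image_subgraph; split; last exact: image_subgraph_iso.
move=> d /= [u ud] [v vd]; apply: (full d u v); rewrite ud vd; exact: joins_ends.
Qed.
End SubgraphOfEmbedding.

Definition between (G : graph) (u v : vert G) : set (edge G) := [set e | joins e u v].

Lemma betweenC (G : graph) (u v : vert G) : between u v = between v u.
Proof. by apply/seteqP; split=> e; apply: joinsC. Qed.

(** A vertex map extends to the edges once the edge sets between corresponding
    pairs are matched.  The properties required of these matchings are a
    parameter, to be injective for subgraphs and bijective for induced
    subgraphs. *)
Lemma extend_to_edges (X Y : graph) (f : vert X -> vert Y)
    (matching : set (edge X) -> set (edge Y) -> (edge X -> edge Y -> Prop) -> Prop) :
  injective f ->
  (forall S S' R, matching S S' R ->
    (forall x, S x -> exists2 y, S' y & R x y) /\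
    (forall x x' y, S x -> S x' -> R x y -> R x' y -> x = x')) ->
  (forall u v, exists R, matching (between u v) (between (f u) (f v)) R) ->
  exists g, embedding f g /\ forall u v, exists R,
    matching (between u v) (between (f u) (f v)) R /\
    forall e, between u v e -> R e (g e).
Proof.
move=> fI mI mX.
(* one matching per pair of edge sets, so that parallel edges share it
   whatever the orientation of their ends *)
have [m mP] := choice_on (P := fun p : set (edge X) * set (edge Y) =>
  exists R, matching p.1 p.2 R) (R := fun p R => matching p.1 p.2 R) (fun _ _ => True)
  (fun p h => h).
pose R u v := m (between u v, between (f u) (f v)).
have RP u v : matching (between u v) (between (f u) (f v)) (R u v) := mP (_, _) (mX u v).
have RC u v : R u v = R v u by rewrite /R betweenC (betweenC (f u)).
have /choice[g gP] e : exists d, joins d (f (ends e).1) (f (ends e).2) /\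
    R (ends e).1 (ends e).2 e d.
  have [T _] := mI _ _ _ (RP (ends e).1 (ends e).2).
  by have [d d1 d2] := T e (joins_ends e); exists d.
have gJ e u v : joins e u v -> joins (g e) (f u) (f v) /\ R u v e (g e).
  have [J Re] := gP e.
  case/(joins_unique (joins_ends e)) => -[<- <-] //.
  by split; [apply: joinsC|rewrite RC].
exists g; split; last first.
  by move=> u v; exists (R u v); split=> // e /gJ[].
split=> // [e e' ee'|e u v /gJ[]//].
have [J Re] := gP e; have [J' Re'] := gP e'.
have e'J : joins e' (ends e).1 (ends e).2.
  move: J'; rewrite -ee' => /(joins_unique J)[] [/fI -> /fI ->]; first exact: joins_ends.
  exact/joinsC/joins_ends.
have [_ I] := mI _ _ _ (RP (ends e).1 (ends e).2).
apply: (I _ _ _ (joins_ends e) e'J Re); rewrite ee'.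
by have [] := gJ _ _ _ e'J.
Qed.

Lemma card_eq_rel T U (A : set T) (B : set U) : A #= B ->
  exists R : T -> U -> Prop,
    [/\ forall x, A x -> exists2 y, B y & R x y,
        forall y, B y -> exists2 x, A x & R x y,
        forall x x' y, A x -> A x' -> R x y -> R x' y -> x = x' &
        forall x y y', R x y -> R x y' -> y = y'].
Proof.
move=> /card_eqP[f].
have fI : injective f by move=> a b; apply: inj; rewrite inE.
exists (fun x y => exists a : A, val a = x /\ val (f a) = y); split.
- move=> x Ax; exists (val (f (SigSub (mem_set Ax)))); first exact/set_mem/valP.
  by exists (SigSub (mem_set Ax)).
- move=> y By; have [a _ fa] : [set f a | a in [set: A]] (SigSub (mem_set By)).
    exact: (surj (f := f)).
  exists (val a); first exact/set_mem/valP.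
  by exists a; rewrite fa.
- move=> x x' y _ _ [a [<- ay]] [b [<- by_]]; congr (val _); apply/fI/val_inj.
  by rewrite ay by_.
- by move=> x y y' [a [ax <-]] [b [bx <-]]; rewrite (val_inj (etrans ax (esym bx))).
Qed.

(** The extra vertex [None] outside the domain provides the default point also
    when the graph is empty. *)
Definition weighted (G : graph) : wgraph cardinal unit :=
  @WGraph _ _ (option (vert G)) None [set v | v <> None]
    (fun u v => Cardinal [set e : edge G | exists x y,
       [/\ u = Some x, v = Some y & joins e x y]])
    (fun=> tt).

Definition card_zero (c : cardinal) : Prop := extent c = set0.

Lemma weightedE (G : graph) (u v : vert G) :
  extent (weight (weighted G) (Some u) (Some v)) = between u v.
Proof.
apply/seteqP; split=> e; first by move=> [x [y [[->] [->]]]].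
by move=> uv; exists u, v.
Qed.

Lemma weighted_le (leM : cardinal -> cardinal -> Prop) (G G' : graph) :
  wgraph_le leM (fun _ _ => True) (weighted G) (weighted G') ->
  exists2 f : vert G -> vert G', injective f &
    forall u v, leM (weight (weighted G) (Some u) (Some v))
                    (weight (weighted G') (Some (f u)) (Some (f v))).
Proof.
move=> [h [hD hI _ hW]].
have /choice[f fP] u : exists x, h (Some u) = Some x.
  have /hD : wdom (weighted G) (Some u) by [].
  case: (h (Some u)) => [x _|nN]; first by exists x.
  by exfalso; apply: nN.
exists f => [u v e|u v].
  by suff [] : Some u = Some v by []; apply: hI => //; rewrite !fP e.
by have := hW (Some u) (Some v); rewrite !fP; apply.
Qed.

Lemma subgraph_le_of_weighted (G G' : graph) :
  wgraph_le cardinal_le (fun _ _ => True) (weighted G) (weighted G') ->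
  subgraph_le G G'.
Proof.
move=> /weighted_le[f fI fW].
have [|||g [fg _]] := @extend_to_edges G G' f (fun S S' R =>
    (forall x, S x -> exists2 y, S' y & R x y) /\
    (forall x x' y, S x -> S x' -> R x y -> R x' y -> x = x')) => //.
  by move=> u v; have := fW u v; rewrite /cardinal_le !weightedE => /card_le_inj.
exact: subgraph_le_of_embedding fg.
Qed.

Definition cardinal_eq (c d : cardinal) : Prop := extent c #= extent d.

Lemma induced_subgraph_le_of_weighted (G G' : graph) :
  wgraph_le cardinal_eq (fun _ _ => True) (weighted G) (weighted G') ->
  induced_subgraph_le G G'.
Proof.
move=> /weighted_le[f fI fW].
have [|||g [fg gm]] := @extend_to_edges G G' f (fun S S' R =>
    [/\ forall x, S x -> exists2 y, S' y & R x y,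
        forall y, S' y -> exists2 x, S x & R x y,
        forall x x' y, S x -> S x' -> R x y -> R x' y -> x = x' &
        forall x y y', R x y -> R x y' -> y = y']) => //.
- by move=> S S' R [].
- by move=> u v; have := fW u v; rewrite /cardinal_eq !weightedE => /card_eq_rel.
apply: (induced_subgraph_le_of_embedding fg) => d u v duv.
have [R [[_ S _ F] Rg]] := gm u v.
have [e euv Red] := S d duv; exists e.
by apply: F (Rg e euv) Red.
Qed.

Lemma simpson_bqo_leq : simpson_bqo (fun=> True) (fun m n : nat => m <= n : Prop).
Proof.
apply: simpson_bqo_seq => u _; apply: contrapT => nu.
have dec n : u n + n <= u 0.
  elim: n => [|n IH]; first by rewrite addn0.
  have : ~ (u n <= u n.+1) by move=> h; apply: nu; exists n.
  by move: IH; lia.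
by have := dec (u 0).+1; lia.
Qed.

(** Equality of two numbers [k, k' <= mu] is the conjunction of [k <= k'] and
    [mu - k <= mu - k'], which are well-orders. *)
Lemma simpson_bqo_bounded_cardinal mu :
  simpson_bqo (fun c => extent c #<= `I_mu) cardinal_eq.
Proof.
pose code c (p : nat * nat) :=
  [/\ extent c #= `I_p.1, p.1 <= mu & p.2 = mu - p.1].
apply: (simpson_bqo_reflect (code := code) _ _
  (simpson_bqo_prod simpson_bqo_leq simpson_bqo_leq)).
  move=> c cmu; have [k ck] : finite_set (extent c) by apply/finite_set_leP; exists mu.
  exists (k, mu - k) => //; split=> //=.
  by rewrite -card_le_II; apply: card_le_trans cmu; have /card_eqPle[] := ck.
move=> c c' [k l] [k' l'] _ _ [/= ck kmu ->] [/= ck' kmu' ->] [/= h1 h2].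
have e : k = k' by lia.
by rewrite e in ck; apply: card_eq_trans ck _; apply: card_esym.
Qed.

(** * Linear graphs and paths *)

(** The graph is laid out on a line, its edges joining consecutive positions.
    Up to isomorphism these are the subgraphs of a one-way infinite path. *)
Definition linear (X : graph) (pos : vert X -> nat) (epos : edge X -> nat) : Prop :=
  [/\ injective pos, injective epos & forall e, exists u v,
    [/\ joins e u v, pos u = epos e & pos v = (epos e).+1]].

Lemma has_path_seq V (a : V -> V -> Prop) n (D : set V) r : has_path a n D r ->
  exists p : nat -> V, [/\ p 0 = r, forall i, i <= n -> D (p i),
    forall i, i < n -> a (p i) (p i.+1) &
    forall i j, i <= n -> j <= n -> p i = p j -> i = j].
Proof.
elim: n D r => [|n IH] D r /= [Dr].
  by exists (fun=> r); split=> // [] [|i] [|j].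
move=> [v rv /IH[p [p0 pD pa pI]]].
exists (fun i => if i is i'.+1 then p i' else r); split=> //.
- by case=> // i /pD[].
- by case=> [_|i /pa//]; rewrite p0.
- case=> [|i] [|j] //= hi hj.
  + by move=> e; have [_] := pD j hj; rewrite -e => /(_ erefl).
  + by move=> e; have [_] := pD i hi; rewrite e => /(_ erefl).
  + by move/(pI i j hi hj) ->.
Qed.

Lemma linear_subgraph_le (X G : graph) pos epos n r :
  @linear X pos epos -> (forall v, pos v <= n) ->
  has_path (adj card_zero (weighted G)) n (wdom (weighted G)) r ->
  subgraph_le X G.
Proof.
move=> [posI eposI linX] posn hp; have [p [_ pD pa pI]] := has_path_seq hp.
have /choice[f fP] v : exists x : vert G, p (pos v) = Some x.
  by have := pD _ (posn v); case: (p (pos v)) => [x _|nN]; [exists x|case: nN].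
have fI : injective f.
  move=> u v e; apply: posI; apply: pI => //; by rewrite !fP e.
have ltn e : epos e < n by have [u [v [_ _ <-]]] := linX e.
have /choice[g gP] e : exists d : edge G, exists x y,
    [/\ p (epos e) = Some x, p (epos e).+1 = Some y & joins d x y].
  apply: contrapT => nd; apply: (pa _ (ltn e)); apply/seteqP; split=> // d dP.
  by apply: nd; exists d.
apply: (@subgraph_le_of_embedding X G f g); split=> // [e e' ee'|e u v].
  have [x [y [px py J]]] := gP e; have [x' [y' [px' py' J']]] := gP e'.
  rewrite -ee' in J'; have := ltn e; have := ltn e' => h h'.
  apply: eposI; case: (joins_unique J J') => -[ex ey].
    by apply: pI; rewrite ?px ?px' ?ex //; apply: ltnW.
  have e1 : epos e = (epos e').+1 by apply: pI; rewrite ?px ?py' ?ex //; apply: ltnW.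
  have e2 : (epos e).+1 = epos e' by apply: pI; rewrite ?py ?px' ?ey //; apply: ltnW.
  by lia.
have [u' [v' [J pu pv]]] := linX e; have [x [y [px py Jg]]] := gP e.
have fu : f u' = x by move: px; rewrite -pu fP => -[].
have fv : f v' = y by move: py; rewrite -pv fP => -[].
rewrite -fu -fv in Jg.
by case/(joins_unique J) => -[<- <-] //; apply: joinsC.
Qed.

Lemma finite_numbering T : finite_set [set: T] ->
  exists n, exists2 c : T -> nat, injective c & forall x, c x < n.
Proof.
move=> /finite_set_leP[n /card_le_inj[R [RT RI]]]; exists n.
have /choice[c cP] x : exists k, k < n /\ R x k.
  by have [//|k kn xk] := RT x; exists k.
exists c => [x y e|x]; last by have [] := cP x.
apply: (RI _ _ (c x)) => //; first by have [] := cP x.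
by rewrite e; have [] := cP y.
Qed.

(** With at most [n] vertices in all, a path has fewer than [n] edges; so the paths are
    placed one after the other in intervals of length [n]. *)
Lemma disjoint_union_of_paths_linear (H : graph) :
  finite_set [set: vert H] -> disjoint_union_of_paths H ->
  exists n pos epos, @linear H pos epos /\ forall v, pos v <= n.
Proof.
move=> /finite_numbering[n [c cI cn]] [I [len [f [g [fB gB fg]]]]].
have [f' fK f'K] := fB.
pose idx i := c (f' (existT _ i ord0)).
have idxI i j : idx i = idx j -> i = j.
  by move=> /cI/(can_inj f'K)/(congr1 (@projT1 _ _)).
have lenn i : len i < n.
  pose h (k : 'I_(len i).+1) : 'I_n := Ordinal (cn (f' (existT _ i k))).
  have hI : injective h.
    move=> k k' /(congr1 val)/= /cI/(can_inj f'K) e.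
    apply: val_inj.
    exact: (congr1 (fun s : {i : I & 'I_(len i).+1} => val (projT2 s)) e).
  by have := leq_card h hI; rewrite !card_ord.
have divE i k : k < n -> (idx i * n + k) %/ n = idx i.
  by move=> kn; rewrite divnMDl ?divn_small ?addn0 //; lia.
have code i j k l : k < n -> l < n -> idx i * n + k = idx j * n + l -> i = j /\ k = l.
  move=> kn ln e; have ij : i = j by apply: idxI; rewrite -(divE i k) // e divE.
  by split=> //; move: e; rewrite ij; lia.
pose pos v := idx (projT1 (f v)) * n + projT2 (f v).
pose epos e := idx (projT1 (g e)) * n + projT2 (g e).
exists (n * n), pos, epos; split; last first.
  move=> v; rewrite /pos; have := ltn_ord (projT2 (f v)).
  have := lenn (projT1 (f v)); have := cn (f' (existT _ (projT1 (f v)) ord0)).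
  by rewrite -/(idx _); nia.
split.
- move=> u v; rewrite /pos => e; apply: (bij_inj fB).
  move: e; case: (f u) (f v) => [i k] [j l] /=.
  case/code => [||ij]; try by apply: leq_trans (lenn _); apply: ltn_ord.
  by subst j => kl; congr (existT _ _ _); apply: val_inj.
- move=> u v; rewrite /epos => e; apply: (bij_inj gB).
  move: e; case: (g u) (g v) => [i k] [j l] /=.
  case/code => [||ij]; try by apply: ltn_trans (lenn _); apply: ltn_ord.
  by subst j => kl; congr (existT _ _ _); apply: val_inj.
move=> e; rewrite /epos; have := fg e _ _ (joins_ends e).
case gE : (g e) => [i k] /= J.
exists (f' (existT _ i (widen_ord (leqnSn _) k))), (f' (existT _ i (lift ord0 k))).
rewrite /pos !f'K /=; split=> //; last by rewrite /bump /= add1n addnS.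
have {}J : joins (existT _ i k : edge (disjoint_union (fun i => path_graph (len i))))
   (f (ends e).1) (f (ends e).2) by [].
case: J => /= -[/= -> ->]; rewrite !fK; first exact: joins_ends.
exact/joinsC/joins_ends.
Qed.

(** * Cycles *)

Lemma finite_bounded T (f : T -> nat) :
  finite_set [set: T] -> exists n, forall x, f x <= n.
Proof.
move=> finT; have /(@finite_seqP {classic T})[s sP] := finT.
exists (\max_(x <- s) f x) => x; apply: leq_bigmax_seq => //.
by have : [set: T] x by []; rewrite sP.
Qed.

(** The components are the maximal runs of edges at consecutive positions, each
    indexed by its leftmost vertex. *)
Lemma linear_disjoint_union_of_paths (X : graph) pos epos :
  finite_set [set: vert X] -> @linear X pos epos -> disjoint_union_of_paths X.
Proof.
move=> finX [posI eposI linX].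
have [n posn] := finite_bounded pos finX.
have eposn e : epos e <= n by have [u [v [_ <- _]]] := linX e.
have stop v : exists k, `[< ~ exists e, epos e = pos v + k >].
  by exists n.+1; apply/asboolP => -[e]; have := eposn e; lia.
pose len v := ex_minn (stop v).
have len_stop v e : epos e <> pos v + len v.
  by rewrite /len; case: ex_minnP => k /asboolP nk _ ek; apply: nk; exists e.
have len_run v k : k < len v -> exists e, epos e = pos v + k.
  rewrite /len; case: ex_minnP => l _ lmin kl.
  by apply: contrapT => /asboolT/lmin; rewrite leqNgt kl.
pose start v := forall e, (epos e).+1 <> pos v.
have run_inj v v' i i' : start v -> start v' -> i <= len v -> i' <= len v' ->
    pos v + i = pos v' + i' -> v = v'.
  wlog le : v v' i i' / pos v <= pos v'.
    move=> W sv sv' hi hi' e; case: (leqP (pos v) (pos v')) => h; first exact: (W _ _ i i').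
    by apply/esym/(W _ _ i' i) => //; apply: ltnW.
  move=> sv sv' hi hi' e; apply: posI; apply/eqP; rewrite eqn_leq le leqNgt.
  apply/negP => lt; have [|d de] := len_run v (pos v' - pos v).-1; first by lia.
  by apply: (sv' d); rewrite de; lia.
pose I := {v | start v}; pose P (i : I) := path_graph (len (sval i)).
have atv (s : vert (disjoint_union P)) : exists x : vert X,
    pos x = pos (sval (projT1 s)) + projT2 s.
  case: s => -[v sv] [[|k] /= hk]; first by exists v; rewrite addn0.
  have [|e ek] := len_run v k; first exact: hk.
  by have [_ [y [_ _ py]]] := linX e; exists y; rewrite py ek addnS.
have ate (s : edge (disjoint_union P)) : exists x : edge X,
    epos x = pos (sval (projT1 s)) + projT2 s.
  by case: s => -[v sv] [k /= hk]; apply: len_run.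
have [F FP] := choice atv; have [G GP] := choice ate.
have FI : injective F.
  move=> [[v sv] k] [[w sw] l] /(congr1 pos); rewrite !FP /= => e.
  have vw : v = w by apply: (run_inj v w k l) => //; rewrite -ltnS; apply: ltn_ord.
  move: e; subst w; rewrite (Prop_irrelevance sw sv) in l * => e.
  by congr existT; apply: val_inj => /=; lia.
have GI : injective G.
  move=> [[v sv] k] [[w sw] l] /(congr1 epos); rewrite !GP /= => e.
  have vw : v = w by apply: (run_inj v w k l) => //; apply: ltnW; apply: ltn_ord.
  move: e; subst w; rewrite (Prop_irrelevance sw sv) in l * => e.
  by congr existT; apply: val_inj => /=; lia.
have Fsurj x : exists s, F s = x.
  have [m] := ubnP (pos x); elim: m x => // m IH x; rewrite ltnS => xm.
  have [sx|/existsNP[e /contrapT ex]] := pselect (start x).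
    exists (existT _ (exist _ x sx : I) (ord0 : vert (P (exist _ x sx)))).
    by apply: posI; rewrite FP /= addn0.
  have [u [v [_ pu pv]]] := linX e.
  have [|[i k] su] := IH u; first by rewrite pu; lia.
  have ku : epos e = pos (sval i) + k by rewrite -pu -su FP.
  have kl : k < len (sval i).
    have := ltn_ord k; rewrite ltnS leq_eqVlt => /predU1P[kE|//].
    by have := @len_stop (sval i) e; rewrite ku kE.
  exists (existT _ i (lift ord0 (Ordinal kl) : vert (P i))); apply: posI.
  by rewrite FP /= /bump /= -ex ku; lia.
have Gsurj e : exists s, G s = e.
  have [u [v [_ pu pv]]] := linX e; have [[i k] su] := Fsurj u.
  have ku : epos e = pos (sval i) + k by rewrite -pu -su FP.
  have kl : k < len (sval i).
    have := ltn_ord k; rewrite ltnS leq_eqVlt => /predU1P[kE|//].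
    by have := @len_stop (sval i) e; rewrite ku kE.
  by exists (existT _ i (Ordinal kl : edge (P i))); apply: eposI; rewrite GP.
have [F' FK FK'] := bijective_of_surjective FI Fsurj.
have [G' GK GK'] := bijective_of_surjective GI Gsurj.
exists I, (fun i => len (sval i)), F', G'; split; [by exists F|by exists G|].
move=> e x y J; have [u [v [J' pu pv]]] := linX e.
suff : joins (G' e) (F' u) (F' v).
  by case: (joins_unique J J') => -[-> ->] // ?; apply: joinsC.
have eG := GP (G' e); rewrite GK' in eG.
case: (G' e) eG => i k /= eG; left => /=; congr (_, _).
  apply: FI; rewrite FK'; apply: posI.
  by rewrite FP /= pu eG.
apply: FI; rewrite FK'; apply: posI.
by rewrite FP /= pv eG /bump /=; lia.
Qed.

Definition cycle_graph (n : nat) : graph := {|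
  vert := 'I_n.+3;
  edge := 'I_n.+3;
  ends := fun i => (i, ordS i)
|}.

Lemma val_ordS n (i : 'I_n.+3) : val (ordS i) = if i == ord_max then 0 else i.+1.
Proof.
rewrite /=; case: eqP => [->|ne]; first by rewrite modnn.
apply: modn_small; have := ltn_ord i; rewrite ltnS leq_eqVlt => /predU1P[e|//].
by case: ne; apply: val_inj; rewrite /= ; lia.
Qed.

Lemma cycle_multiplicity mu n : 0 < mu -> multiplicity_le mu (cycle_graph n).
Proof.
move=> mu0 u v; apply: (@card_le_rel _ _ _ _ (fun _ k => k = 0)).
  by move=> e _; exists 0.
move=> e e' _ J J' _ _; move: J J'.
rewrite /joins /= => -[[eu Sv]|[ev Su]] [[eu' Sv']|[ev' Su']].
- by rewrite eu eu'.
- have := val_ordS e; have := val_ordS e'; rewrite Sv Su' -ev' -eu.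
  case: eqP => [->|_]; case: eqP => [->|_] //=; lia.
- have := val_ordS e; have := val_ordS e'; rewrite Su Sv' -ev -eu'.
  case: eqP => [->|_]; case: eqP => [->|_] //=; lia.
- by rewrite ev ev'.
Qed.

(** A subgraph of a cycle that misses the vertex [m] is laid out by walking
    around the cycle from [m]. *)
Lemma cut_cycle_linear X n f g (m : 'I_n.+3) :
  @embedding X (cycle_graph n) f g -> (forall u, f u <> m) ->
  exists pos epos, @linear X pos epos.
Proof.
move=> [fI gI J] fm.
pose unroll (i : 'I_n.+3) : nat := if i < m then i + n.+3 else i.
have unrollI : injective unroll.
  move=> i j; rewrite /unroll => h; apply: val_inj => /=; move: h.
  have hi := ltn_ord i; have hj := ltn_ord j.
  by case: ltnP => ?; case: ltnP => ?; lia.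
exists (unroll \o f), (unroll \o g); split.
- exact: inj_comp.
- exact: inj_comp.
move=> e.
have [u [v [Je fu fv]]] : exists u v, [/\ joins e u v, f u = g e & f v = ordS (g e)].
  case: (J _ _ _ (joins_ends e)) => -[-> ->].
    by exists (ends e).1, (ends e).2; split=> //; apply: joins_ends.
  by exists (ends e).2, (ends e).1; split=> //; apply/joinsC/joins_ends.
exists u, v; split=> //=; first by rewrite fu.
have nm k : f k <> m :> nat by move=> /val_inj/fm.
have nmu := nm u; have nmv := nm v; rewrite fu in nmu; rewrite fv val_ordS in nmv.
rewrite fv /unroll val_ordS.
have hm := ltn_ord m; move: nmu nmv; case: eqP => [->|_] /= nmu nmv.
  by case: ltnP => ?; case: ltnP => ?; lia.
by case: ltnP => ?; case: ltnP => ?; lia.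
Qed.

(** The leftmost vertex of a linear graph meets at most one edge, but each vertex
    of a cycle meets two. *)
Lemma cycle_not_linear n pos epos : ~ @linear (cycle_graph n) pos epos.
Proof.
move=> [posI eposI linC].
have [/= v _ vmin] := @arg_minnP 'I_n.+3 ord0 predT pos isT.
have at_v (e : 'I_n.+3) w : @joins (cycle_graph n) e v w -> epos e = pos v.
  move=> J; have [x [y [J' px py]]] := linC e.
  case: (joins_unique J J') => -[vx wy]; first by rewrite vx.
  by have := vmin x isT; rewrite vx px py ltnn.
have e1 : epos v = pos v by apply: (at_v _ (ordS v)); left.
have e2 : epos (ord_pred v) = pos v.
  by apply: (at_v _ (ord_pred v)); right; rewrite /= ord_predK.
have /(congr1 (@ordS _)) : v = ord_pred v by apply: eposI; rewrite e1 e2.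
rewrite ord_predK => /(congr1 val); rewrite val_ordS.
by case: eqP => [->|_] /=; lia.
Qed.

Lemma embedding_misses X n k f (c : vert X -> nat) :
  injective f -> injective c -> (forall x, c x < k) -> k < n.+3 ->
  exists m : vert (cycle_graph n), forall u : vert X, f u <> m.
Proof.
move=> fI cI ck kn; apply: contrapT => nm.
have /choice[h hP] (m : 'I_n.+3) : exists u, f u = m.
  by apply: contrapT => nu; apply: nm; exists m => u e; apply: nu; exists u.
pose d m : 'I_k := Ordinal (ck (h m)).
have dI : injective d by move=> i j /(congr1 val) /= /cI e; rewrite -(hP i) -(hP j) e.
by have := leq_card d dI; rewrite !card_ord; lia.
Qed.

Lemma singletons_block : block (fun A : seq nat => size A = 1).
Proof.
split.
- by case=> [|a []].
- apply/infiniteP; apply: (@card_le_rel _ _ _ _ (fun n A => A = [:: n])).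
    by move=> n _; exists [:: n].
  by move=> n n' _ _ _ -> [].
- by move=> s _ _; exists 1.
Qed.

(** The long cycles form an infinite antichain: a smaller cycle inside a larger
    one would miss a vertex and hence be linear.  For the same reason a graph
    [H] that is not a disjoint union of paths is contained in none of them. *)
Lemma disjoint_union_of_paths_of_bqo H (Q : graph -> Prop) le :
  finite_set [set: vert H] -> (forall X Y, le X Y -> subgraph_le X Y) ->
  (forall n, ~ subgraph_le H (cycle_graph n) -> Q (cycle_graph n)) ->
  better_quasi_ordered Q le -> disjoint_union_of_paths H.
Proof.
move=> finH le_sub QC bQ; apply: contrapT => nH.
have [k [c cI ck]] := finite_numbering finH.
have nHC n : k <= n -> ~ subgraph_le H (cycle_graph n).
  move=> kn /subgraph_leE[f [g fg]]; have [fI _ _] := fg.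
  have [|m fm] := embedding_misses (n := n) fI cI ck; first by lia.
  have [pos [epos lin]] := cut_cycle_linear fg fm.
  exact/nH/linear_disjoint_union_of_paths/lin.
have [A [A' [[C [ascC preC _ A'C]] leAA']]] := bQ _ singletons_block
  (fun A => cycle_graph (k + head 0 (sval A)))
  (fun A => QC _ (nHC _ (leq_addr _ _))).
move: A A' preC A'C leAA' => [[|a [|//]] //= _] [[|b [|//]] //= _].
case: C ascC => [|a' C] // ascC preC /= CE; move: ascC preC; rewrite -CE.
rewrite /ascending /= !andbT => ab /eqP aa'; subst a'.
move=> /le_sub/subgraph_leE[f [g fg]]; have [fI _ _] := fg.
have [|m fm] := embedding_misses (n := k + b) fI val_inj (@ltn_ord (k + a).+3).
  by lia.
have [pos [epos lin]] := cut_cycle_linear fg fm.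
exact: cycle_not_linear lin.
Qed.

(** * Excluding a disjoint union of paths *)

(** A path of [n] edges contains [H] when [n] bounds the positions in a linear
    layout of [H]. *)
Lemma depth_bounded_of_excluded (H : graph) :
  finite_set [set: vert H] -> disjoint_union_of_paths H ->
  exists n, forall (QM : cardinal -> Prop) (G : graph), ~ subgraph_le H G ->
    (forall u v : vert G, QM (Cardinal (between u v))) ->
    depth_le QM card_zero (fun=> True) n (weighted G).
Proof.
move=> finH /(disjoint_union_of_paths_linear finH)[n [pos [epos [lin posn]]]].
exists n => QM G nHG QG; split.
  split=> // [u v|[u|] [v|] // _ _].
    congr Cardinal; apply/seteqP.
    by split=> e [x [y [-> -> xy]]]; exists y, x; split=> //; apply: joinsC.
  have -> : weight (weighted G) (Some u) (Some v) = Cardinal (between u v).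
    by rewrite -weightedE.
  exact: QG.
move=> v Dv; exists v; split; first exact: conn_refl.
by move=> /(linear_subgraph_le lin posn).
Qed.

Lemma excluded_simpson_bqo (H : graph) (QM : cardinal -> Prop)
    (leM : cardinal -> cardinal -> Prop) (le : graph -> graph -> Prop) :
  finite_set [set: vert H] -> disjoint_union_of_paths H ->
  (forall c, leM c c) -> (forall d c e, leM c d -> leM d e -> leM c e) ->
  (forall c d, card_zero c -> card_zero d -> leM c d) ->
  simpson_bqo QM leM ->
  (forall G G', wgraph_le leM (fun _ _ => True) (weighted G) (weighted G') -> le G G') ->
  simpson_bqo (fun G => (forall u v : vert G, QM (Cardinal (between u v))) /\
                        ~ subgraph_le H G) le.
Proof.
move=> finH pathsH rM tM zM bM leW.
have [n nP] := depth_bounded_of_excluded finH pathsH.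
have bT : simpson_bqo (fun _ : unit => True) (fun _ _ => True).
  by move=> g _ _; exists id.
have := bounded_depth_bqo rM tM bM zM (n := n) (fun=> I) (fun _ _ _ _ _ => I) bT.
apply: (simpson_bqo_reflect (code := fun G w => w = weighted G)).
  by move=> G [QG nHG]; exists (weighted G) => //; apply: nP.
by move=> G G' _ _ _ _ -> ->; apply: leW.
Qed.

Theorem theorem1p1 (H : graph) (finH : finite_graph H) :
  (better_quasi_ordered (fun G => ~ subgraph_le H G) subgraph_le
     <-> disjoint_union_of_paths H) /\
  (forall mu : nat, (1 <= mu)%N ->
     (better_quasi_ordered
        (fun G => multiplicity_le mu G /\ ~ subgraph_le H G)
        induced_subgraph_le
      <-> disjoint_union_of_paths H)).
Proof.
have [finV _] := finH; split=> [|mu mu0]; split.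
- exact: disjoint_union_of_paths_of_bqo.
- move=> pathsH; apply: simpson_bqo_block.
  apply: (simpson_bqo_reflect (code := eq)) (excluded_simpson_bqo finV pathsH
    _ _ _ simpson_bqo_cardinal subgraph_le_of_weighted).
  + by move=> G nHG; exists G.
  + by move=> G G' _ _ _ _ <- <-.
  + by move=> c; apply: card_lexx.
  + by move=> d c e; apply: card_le_trans.
  + by move=> c d c0 _; rewrite /cardinal_le c0; apply: card_ge0.
- apply: disjoint_union_of_paths_of_bqo => // [X Y [S [_ iso]]|n]; first by exists S.
  by split=> //; apply: cycle_multiplicity.
- move=> pathsH; apply: simpson_bqo_block.
  apply: (excluded_simpson_bqo (leM := cardinal_eq)
    (QM := fun c => extent c #<= `I_mu)) => //.
  + by move=> c; apply: card_eqxx.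
  + by move=> d c e; apply: card_eq_trans.
  + by move=> c d; rewrite /cardinal_eq => -> ->; apply: card_eq00.
  + exact: simpson_bqo_bounded_cardinal.
  + exact: induced_subgraph_le_of_weighted.
Qed.
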